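(* 1. Suppose that for every $n\in\mathbb{N}$ and every $n$-dimensional monotone polytope $P\subset\mathbb{R}^n$ the set $\mathcal{E}(P)$ contains a unimodular basis of $\mathbb{Z}^n$ (Ewald's Conjecture). Then every monotone polytope is neat. 2. Suppose that for every $n\in\mathbb{N}$ and every $n$-dimensional smooth lattice polytope $P\subset\mathbb{R}^n$ with the origin in its interior the set $\mathcal{E}(P)$ contains a unimodular basis of $\mathbb{Z}^n$ (Nill's General Ewald Conjecture). Then every lattice smooth polytope is neat.
   Context: A unimodular basis of $\mathbb{Z}^n$ is a $\mathbb{Z}$-basis of $\mathbb{Z}^n$. The Ewald set of a polytope $P\subset\mathbb{R}^n$ is $\mathcal{E}(P):=\mathbb{Z}^n\cap P\cap(-P)$. An $n$-dimensional polytope in $\mathbb{R}^n$ is smooth if it is simple (precisely $n$ edges meet at each vertex), rational (it has rational edge directions), and the primitive edge-direction vectors at each vertex form a basis of $\mathbb{Z}^n$; it is a lattice polytope if its vertices are in $\mathbb{Z}^n$, and a lattice smooth polytope (equivalently, smooth lattice polytope) if it is both. A lattice polytope with the origin in its interior is reflexive if every facet-defining inequality is of the form $u_F\cdot x\le 1$ with $u_F\in\mathbb{Z}^n$ the primitive exterior normal vector of the facet; monotone means smooth and reflexive. Two polytopes in the same space are normally isomorphic if they have the same normal fan. Neat. Let $m,n\in\mathbb{N}$ and let $P=\{x\in\mathbb{R}^n: Ax\le c\}$ be the irredundant facet description of a smooth lattice polytope, with $A\in\mathbb{Z}^{m\times n}$ having primitive rows and $c\in\mathbb{Z}^m$. For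 $b\in\mathbb{Z}^m$ put $P_b:=\{x\in\mathbb{R}^n: Ax\le c+b\}$. $P$ is neat if for every $b\in\mathbb{Z}^m$ such that both $P_b$ and $P_{-b}$ are normally isomorphic to $P$, one has $P_b\cap(-P_{-b})\cap\mathbb{Z}^n\neq\varnothing$; that is, there is an integer point $x\in P_b$ such that $-x\in P_{-b}$.
   Formalization: In part 2 the conclusion is stated for lattice smooth polytopes containing the origin (possibly on the boundary): taking b = 0 shows that a neat polytope must contain the origin, so for instance [1,2] in R^1 is never neat. *)

(* Defs.v *)
From HB Require Import structures.
From mathcomp Require Import all_boot all_order all_algebra.
From mathcomp Require Import all_classical all_reals all_analysis.

Set Implicit Arguments.
Unset Strict Implicit.
Unset Printing Implicit Defensive.

Import Order.TTheory GRing.Theory Num.Theory.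
Import numFieldNormedType.Exports.

Local Open Scope classical_set_scope.
Local Open Scope ring_scope.

(* Points of R^n and Z^n, as well as linear functionals, are column vectors. *)

Definition Zbasis (n : nat) (e : 'I_n -> 'cV[int]_n) : Prop :=
  forall z : 'cV[int]_n, exists! a : 'cV[int]_n, z = \sum_i a i 0 *: e i.

Definition primitive (n : nat) (z : 'cV[int]_n) : Prop :=
  \big[gcdn/0%N]_(i < n) `|(z i 0)%R|%N = 1%N.

Section Polytopes.
Variable R : realType.

Definition real_mx (m n : nat) (A : 'M[int]_(m, n)) : 'M[R]_(m, n) :=
  map_mx intr A.

Definition integer_points (n : nat) : set 'cV[R]_n := range (@real_mx n 1).

Definition dotv (n : nat) (u x : 'cV[R]_n) : R := (u^T *m x) 0 0.

Definition convex_hull_seq (n : nat) (s : seq 'cV[R]_n) : set 'cV[R]_n :=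
  [set x | exists w : 'I_(size s) -> R,
    [/\ forall i, 0 <= w i, \sum_i w i = 1 & x = \sum_i w i *: s`_i]].

Definition polytope (n : nat) (P : set 'cV[R]_n) : Prop :=
  exists s : seq 'cV[R]_n, P = convex_hull_seq s.

(* [affine_dim S d]: S contains d + 1 affinely independent points, namely x0
   and the points x0 + (column j of V), whose affine span contains S. *)
Definition affine_dim (n : nat) (S : set 'cV[R]_n) (d : nat) : Prop :=
  exists (x0 : 'cV[R]_n) (V : 'M[R]_(n, d)),
    [/\ S x0, forall j, S (x0 + col j V), \rank V = d &
        forall x, S x -> exists w : 'cV[R]_d, x = x0 + V *m w].

(* Nonempty faces; P itself is a face (take u = 0). *)
Definition face (n : nat) (P F : set 'cV[R]_n) : Prop :=
  F !=set0 /\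
  exists u : 'cV[R]_n,
    F = [set x | P x /\ forall y, P y -> dotv u y <= dotv u x].

Definition vertex (n : nat) (P : set 'cV[R]_n) (v : 'cV[R]_n) : Prop :=
  face P [set v].

Definition edge (n : nat) (P E : set 'cV[R]_n) : Prop :=
  face P E /\ affine_dim E 1.

(* There is no facet when n = 0. *)
Definition facet (n : nat) (P F : set 'cV[R]_n) : Prop :=
  face P F /\ exists2 d : nat, d.+1 = n & affine_dim F d.

Definition normal_cone (n : nat) (P F : set 'cV[R]_n) : set 'cV[R]_n :=
  [set u | forall x y, F x -> P y -> dotv u y <= dotv u x].

Definition normal_fan (n : nat) (P : set 'cV[R]_n) : set (set 'cV[R]_n) :=
  [set normal_cone P F | F in face P].

Definition normally_isomorphic (n : nat) (P Q : set 'cV[R]_n) : Prop :=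
  normal_fan P = normal_fan Q.

Definition edge_direction (n : nat) (E : set 'cV[R]_n) (d : 'cV[R]_n) : Prop :=
  d != 0 /\ forall x y, E x -> E y -> exists t : R, y - x = t *: d.

Definition simple_polytope (n : nat) (P : set 'cV[R]_n) : Prop :=
  forall v, vertex P v -> ([set E | edge P E /\ E v] #= `I_n)%card.

Definition rational_polytope (n : nat) (P : set 'cV[R]_n) : Prop :=
  forall E, edge P E -> exists z : 'cV[int]_n, edge_direction E (real_mx z).

(* Primitive direction vectors of the edges at v, pointing away from v. *)
Definition primitive_edge_vectors (n : nat) (P : set 'cV[R]_n) (v : 'cV[R]_n) :
    set 'cV[int]_n :=
  [set z | primitive z /\ exists E, [/\ edge P E, E v &
     exists2 t : R, 0 < t & E (v + t *: real_mx z)]].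

(* n-dimensional smooth polytope in R^n *)
Definition smooth_polytope (n : nat) (P : set 'cV[R]_n) : Prop :=
  [/\ polytope P, affine_dim P n, simple_polytope P, rational_polytope P &
      forall v, vertex P v ->
        exists2 e : 'I_n -> 'cV[int]_n,
          Zbasis e & primitive_edge_vectors P v = range e].

Definition lattice_polytope (n : nat) (P : set 'cV[R]_n) : Prop :=
  polytope P /\ forall v, vertex P v -> integer_points v.

(* The inequality u . x <= r is valid on P and defines F; in particular, if F
   is a facet of the n-dimensional polytope P, u is an exterior normal to F. *)
Definition defining_inequality (n : nat) (P F : set 'cV[R]_n)
    (u : 'cV[R]_n) (r : R) : Prop :=
  P `<=` [set x | dotv u x <= r] /\ F = P `&` [set x | dotv u x = r].

Definition reflexive_polytope (n : nat) (P : set 'cV[R]_n) : Prop :=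
  [/\ lattice_polytope P, interior P 0 &
      forall F, facet P F ->
        exists2 u : 'cV[int]_n,
          primitive u & defining_inequality P F (real_mx u) 1].

Definition monotone_polytope (n : nat) (P : set 'cV[R]_n) : Prop :=
  smooth_polytope P /\ reflexive_polytope P.

Definition ewald_set (n : nat) (P : set 'cV[R]_n) : set 'cV[R]_n :=
  @integer_points n `&` P `&` [set - x | x in P].

Definition has_unimodular_basis (n : nat) (S : set 'cV[R]_n) : Prop :=
  exists2 e : 'I_n -> 'cV[int]_n, Zbasis e & forall i, S (real_mx (e i)).

Definition polyhedron (m n : nat) (A : 'M[int]_(m, n)) (c : 'cV[int]_m) :
    set 'cV[R]_n :=
  [set x | forall i, (real_mx A *m x) i 0 <= (c i 0)%:~R].

Definition facet_description (m n : nat) (A : 'M[int]_(m, n)) (c : 'cV[int]_m)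
    (P : set 'cV[R]_n) : Prop :=
  [/\ P = polyhedron A c,
      forall i, primitive (row i A)^T,
      forall i, facet P (P `&` [set x | (real_mx A *m x) i 0 = (c i 0)%:~R]) &
      (* irredundancy: no inequality can be removed *)
      forall i, P <> [set x | forall j, j != i ->
                       (real_mx A *m x) j 0 <= (c j 0)%:~R]].

(* The irredundant facet description of a full-dimensional polytope is unique
   up to the order of the rows, on which the condition does not depend. *)
Definition neat (n : nat) (P : set 'cV[R]_n) : Prop :=
  forall (m : nat) (A : 'M[int]_(m, n)) (c : 'cV[int]_m),
    facet_description A c P ->
    forall b : 'cV[int]_m,
      normally_isomorphic (polyhedron A (c + b)) P ->
      normally_isomorphic (polyhedron A (c - b)) P ->
      polyhedron A (c + b) `&` [set - x | x in polyhedron A (c - b)]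
        `&` @integer_points n !=set0.

(* The case b = 0: a neat polytope contains the origin. *)
Lemma neat_origin (n m : nat) (A : 'M[int]_(m, n)) (c : 'cV[int]_m)
    (P : set 'cV[R]_n) : facet_description A c P -> neat P -> P 0.
Proof.
move=> dP neatP; have [PE _ _ _] := dP.
have [||x [[Px [y Py yx]] _]] := neatP _ _ _ dP 0.
- by rewrite addr0 /normally_isomorphic -PE.
- by rewrite subr0 /normally_isomorphic -PE.
rewrite PE => i; rewrite mulmx0 mxE.
move: Px Py; rewrite addr0 subr0 => /(_ i) + /(_ i).
rewrite -yx mulmxN mxE => ? ?.
by rewrite -(pmulrn_lge0 _ (isT : 0 < 2)%N) mulr2n -(addNr ((real_mx A *m y) i 0)) lerD.
Qed.

End Polytopes.

Definition ewald_conjecture (R : realType) : Prop :=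
  forall (n : nat) (P : set 'cV[R]_n),
    monotone_polytope P -> has_unimodular_basis (ewald_set P).

Definition general_ewald_conjecture (R : realType) : Prop :=
  forall (n : nat) (P : set 'cV[R]_n),
    smooth_polytope P -> lattice_polytope P -> interior P 0 ->
    has_unimodular_basis (ewald_set P).

(* Main.v *)
Require Import Defs.
From mathcomp Require Import all_boot all_order all_algebra.
From mathcomp Require Import all_classical all_reals all_analysis.
From mathcomp Require Import ring lra.

(** The argument is the following. Given b, consider in one more dimension the
    prism Q of the points (x, t) with A x <= c + t b and -1 <= t <= 1. Its
    sections at height 1 and -1 are P_b and P_(-b). If Q is covered by the
    conjecture, the lattice points of Q and -Q contain a lattice basis; the
    heights of the basis vectors lie in {-1, 0, 1} and do not all vanish, so
    that there is, up to sign, a lattice point (x, 1) in Q with (-x, -1) in Q,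
    that is, x in P_b with -x in P_(-b).

    That Q is a smooth lattice polytope is shown through its halfspace
    description: it suffices that Q has no direction of recession and that, at
    each of its points, the tight rows have an integer dual family
    ([unimodular_presentation]; [unimodular_smooth] and [unimodular_lattice]
    recover the polytope notions from it). Conversely, the tight rows at a
    vertex v of the smooth polytope P have such a family, given by the opposites
    of the primitive edge vectors ([smooth_vertex_dual]): the edges at v
    generate the tangent cone, so a facet through v is a coordinate hyperplane
    of the edge basis. Normal isomorphism provides vertices of P_b and P_(-b)
    with the same tight rows as v ([normal_fan_vertex]). Their convex
    combinations show that the rows that are tight at a point of Q are always
    among the tight rows of a vertex of P ([deformation_tight]), and the rows
    that bound the height do not disturb unimodularity ([prism_dual]). If P is
    monotone, then all the bounds of Q are 1, and Q is monotone
    ([unimodular_reflexive]).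

    If the origin is on the boundary of P, it is on the boundary of Q, and the
    conjecture has to be applied to the smallest face G of Q that contains it.
    In place of choosing lattice coordinates on the span of G, one projects the
    ambient space onto this span along the dual vectors of the rows T that cut
    out G, and applies the conjecture to the product of G with a cube, which is
    the set of points that project to G and on which the rows in T range over
    [-1, 1] ([padded_unimodular]). The projection maps the resulting lattice
    basis to points of G and -G that do not all have height 0
    ([ewald_point_at_height]). *)

Set Implicit Arguments.
Unset Strict Implicit.
Unset Printing Implicit Defensive.

Import Order.TTheory GRing.Theory Num.Theory.
Import numFieldNormedType.Exports.
Local Open Scope classical_set_scope.
Local Open Scope ring_scope.

(** * Scalar products *)

Definition dotz (n : nat) (u x : 'cV[int]_n) : int := (u^T *m x) 0 0.

Lemma dotvE (R : realType) n (u x : 'cV[R]_n) :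
  dotv u x = \sum_k u k 0 * x k 0.
Proof. by rewrite /dotv mxE; apply: eq_bigr => k _; rewrite mxE. Qed.

Lemma dotzE n (u x : 'cV[int]_n) : dotz u x = \sum_k u k 0 * x k 0.
Proof. by rewrite /dotz mxE; apply: eq_bigr => k _; rewrite mxE. Qed.

Lemma dotv_real (R : realType) n (u x : 'cV[int]_n) :
  dotv (real_mx R u) (real_mx R x) = (dotz u x)%:~R.
Proof.
rewrite dotvE dotzE rmorph_sum; apply: eq_bigr => k _.
by rewrite rmorphM /real_mx !mxE.
Qed.

Lemma real_mx_dot (R : realType) m n (A : 'M[int]_(m, n)) x i :
  (real_mx R A *m x) i 0 = dotv (real_mx R (row i A)^T) x.
Proof. by rewrite dotvE mxE; apply: eq_bigr => k _; rewrite !mxE. Qed.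

Lemma dotvC (R : realType) n (u x : 'cV[R]_n) : dotv u x = dotv x u.
Proof. by rewrite !dotvE; apply: eq_bigr => k _; rewrite mulrC. Qed.

Lemma dotvDr (R : realType) n (u x y : 'cV[R]_n) :
  dotv u (x + y) = dotv u x + dotv u y.
Proof. by rewrite /dotv mulmxDr mxE. Qed.

Lemma dotvZr (R : realType) n (u x : 'cV[R]_n) t :
  dotv u (t *: x) = t * dotv u x.
Proof. by rewrite /dotv -scalemxAr mxE. Qed.

Lemma dotvNr (R : realType) n (u x : 'cV[R]_n) : dotv u (- x) = - dotv u x.
Proof. by rewrite /dotv mulmxN mxE. Qed.

Lemma dotvBr (R : realType) n (u x y : 'cV[R]_n) :
  dotv u (x - y) = dotv u x - dotv u y.
Proof. by rewrite dotvDr dotvNr. Qed.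

Lemma dotv0r (R : realType) n (u : 'cV[R]_n) : dotv u 0 = 0.
Proof. by rewrite /dotv mulmx0 mxE. Qed.

Lemma dotv_sumr (R : realType) n (u : 'cV[R]_n) (I : Type) (r : seq I)
    (P : pred I) (F : I -> 'cV[R]_n) :
  dotv u (\sum_(i <- r | P i) F i) = \sum_(i <- r | P i) dotv u (F i).
Proof.
exact: (big_morph (dotv u) (@dotvDr R n u) (@dotv0r R n u)).
Qed.

Lemma dotvDl (R : realType) n (u v x : 'cV[R]_n) :
  dotv (u + v) x = dotv u x + dotv v x.
Proof. by rewrite !(dotvC _ x) dotvDr. Qed.

Lemma dotvZl (R : realType) n (u x : 'cV[R]_n) t :
  dotv (t *: u) x = t * dotv u x.
Proof. by rewrite !(dotvC _ x) dotvZr. Qed.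

Lemma dotvNl (R : realType) n (u x : 'cV[R]_n) : dotv (- u) x = - dotv u x.
Proof. by rewrite !(dotvC _ x) dotvNr. Qed.

Lemma dotv0l (R : realType) n (x : 'cV[R]_n) : dotv 0 x = 0.
Proof. by rewrite dotvC dotv0r. Qed.

Lemma dotv_suml (R : realType) n (x : 'cV[R]_n) (I : Type) (r : seq I)
    (P : pred I) (F : I -> 'cV[R]_n) :
  dotv (\sum_(i <- r | P i) F i) x = \sum_(i <- r | P i) dotv (F i) x.
Proof. by rewrite dotvC dotv_sumr; apply: eq_bigr => i _; rewrite dotvC. Qed.

Lemma dotv_eq0 (R : realType) n (x : 'cV[R]_n) : dotv x x = 0 -> x = 0.
Proof.
rewrite dotvE => /eqP; rewrite psumr_eq0 => [/allP x0|k _]; last first.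
  by rewrite -expr2 sqr_ge0.
apply/colP => k; rewrite mxE; apply/eqP.
by have := x0 k (mem_index_enum k); rewrite mulf_eq0 orbb.
Qed.

Lemma dotv_col_mx (R : realType) p q (u x : 'cV[R]_p) (v y : 'cV[R]_q) :
  dotv (col_mx u v) (col_mx x y) = dotv u x + dotv v y.
Proof. by rewrite /dotv tr_col_mx mul_row_col mxE. Qed.

Lemma dotzC n (u x : 'cV[int]_n) : dotz u x = dotz x u.
Proof. by rewrite !dotzE; apply: eq_bigr => k _; rewrite mulrC. Qed.

Lemma dotzDr n (u x y : 'cV[int]_n) : dotz u (x + y) = dotz u x + dotz u y.
Proof. by rewrite /dotz mulmxDr mxE. Qed.

Lemma dotzZr n (u x : 'cV[int]_n) t : dotz u (t *: x) = t * dotz u x.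
Proof. by rewrite /dotz -scalemxAr mxE. Qed.

Lemma dotzNr n (u x : 'cV[int]_n) : dotz u (- x) = - dotz u x.
Proof. by rewrite /dotz mulmxN mxE. Qed.

Lemma dotz0r n (u : 'cV[int]_n) : dotz u 0 = 0.
Proof. by rewrite /dotz mulmx0 mxE. Qed.

Lemma dotz_sumr n (u : 'cV[int]_n) (I : Type) (r : seq I) (P : pred I)
    (F : I -> 'cV[int]_n) :
  dotz u (\sum_(i <- r | P i) F i) = \sum_(i <- r | P i) dotz u (F i).
Proof. exact: (big_morph (dotz u) (@dotzDr n u) (@dotz0r n u)). Qed.

Lemma dotz0l n (x : 'cV[int]_n) : dotz 0 x = 0.
Proof. by rewrite dotzC dotz0r. Qed.

Lemma dotz_col_mx p q (u x : 'cV[int]_p) (v y : 'cV[int]_q) :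
  dotz (col_mx u v) (col_mx x y) = dotz u x + dotz v y.
Proof. by rewrite /dotz tr_col_mx mul_row_col mxE. Qed.

(** * Polyhedra in halfspace form *)

Definition halfspaces (R : realType) (I : finType) n (a : I -> 'cV[R]_n)
    (d : I -> R) : set 'cV[R]_n :=
  [set x | forall i, dotv (a i) x <= d i].

Definition tight (R : realType) (I : finType) n (a : I -> 'cV[R]_n)
    (d : I -> R) (x : 'cV[R]_n) : {set I} :=
  [set i | dotv (a i) x == d i].

Definition trivial_recession (R : realType) (I : finType) n
    (a : I -> 'cV[R]_n) : Prop :=
  forall z, (forall i, dotv (a i) z <= 0) -> z = 0.

(** The algebraic counterpart of a vertex. Such a point is determined by its
    tight set, which makes finiteness evident, and induction over tight sets
    leads to it. *)
Definition basic_point (R : realType) (I : finType) n (a : I -> 'cV[R]_n)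
    (d : I -> R) (x : 'cV[R]_n) : Prop :=
  halfspaces a d x /\
  forall z, (forall i, i \in tight a d x -> dotv (a i) z = 0) -> z = 0.

Lemma tightP (R : realType) (I : finType) n (a : I -> 'cV[R]_n)
    (d : I -> R) (x : 'cV[R]_n) i :
  i \in tight a d x -> dotv (a i) x = d i.
Proof. by rewrite inE => /eqP. Qed.

Lemma small_step (R : realType) (I : finType) n (a : I -> 'cV[R]_n)
    (d : I -> R) (x z : 'cV[R]_n) :
  halfspaces a d x ->
  (forall i, i \in tight a d x -> dotv (a i) z <= 0) ->
  exists2 e : R, 0 < e & halfspaces a d (x + e *: z).
Proof.
move=> ax az.
(* at a tight row, q is 0 because the inverse of 0 is 0 *)
pose q i := `|dotv (a i) z| / (d i - dotv (a i) x).
have q0 i : 0 <= q i by rewrite divr_ge0 // subr_ge0; exact: ax.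
pose s := \sum_i q i.
have s0 : 0 <= s by apply: sumr_ge0.
have s1 : 0 < 1 + s by lra.
exists (1 + s)^-1; first by rewrite invr_gt0.
move=> i; rewrite dotvDr dotvZr.
have [it|] := boolP (i \in tight a d x).
  rewrite (tightP it) gerDl pmulr_rle0 ?invr_gt0 //; exact: az.
rewrite inE => nt; have gap : 0 < d i - dotv (a i) x.
  by rewrite subr_gt0 lt_neqAle nt; exact: ax.
rewrite -lerBrDl ler_pdivrMl //.
have -> : (1 + s) * (d i - dotv (a i) x) =
    (d i - dotv (a i) x) + s * (d i - dotv (a i) x) by ring.
have : q i * (d i - dotv (a i) x) <= s * (d i - dotv (a i) x).
  rewrite ler_pM2r // /s (bigD1 i) //= lerDl sumr_ge0 //.
rewrite /q divfK ?gt_eqF // => /(le_trans (ler_norm _)) h; lra.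
Qed.

(** Moving in a direction that leaves the tight constraints tight, one stops
    at the first constraint that becomes tight. *)
Lemma step_to_tight (R : realType) (I : finType) n (a : I -> 'cV[R]_n)
    (d : I -> R) (x z : 'cV[R]_n) k :
  halfspaces a d x -> (forall i, i \in tight a d x -> dotv (a i) z = 0) ->
  0 < dotv (a k) z ->
  exists s : R, [/\ 0 < s, halfspaces a d (x + s *: z) &
    tight a d x \proper tight a d (x + s *: z)].
Proof.
move=> ax az zk.
pose F i := (d i - dotv (a i) x) / dotv (a i) z.
case: (@arg_minP _ _ I k (fun i => 0 < dotv (a i) z) F zk) => j zj Fj.
have ntj : j \notin tight a d x.
  by apply/negP => /az jz; rewrite jz ltxx in zj.
have gap : 0 < d j - dotv (a j) x.
  by move: ntj; rewrite inE subr_gt0 lt_neqAle => ->; exact: ax.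
have F0 : 0 < F j by rewrite divr_gt0.
exists (F j); split => //.
  move=> i; rewrite dotvDr dotvZr; have [zi|zi] := ltP 0 (dotv (a i) z).
    by have := Fj i zi; rewrite {2}/F ler_pdivlMr //; lra.
  have : F j * dotv (a i) z <= 0 by rewrite pmulr_rle0.
  have := ax i; lra.
apply/properP; split.
  apply/fintype.subsetP => i it.
  by rewrite inE dotvDr dotvZr az // mulr0 addr0 (tightP it).
exists j => //; rewrite inE dotvDr dotvZr /F divfK ?(gt_eqF zj) //.
by rewrite addrC subrK.
Qed.

(** A point that is not basic lies on a segment, in a direction that preserves
    its tight constraints; both ends of the segment have more of these. *)
Lemma halfspaces_ind (R : realType) (I : finType) n (a : I -> 'cV[R]_n)
    (d : I -> R) (S : set 'cV[R]_n) :
  trivial_recession a ->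
  (forall x y t, 0 <= t -> t <= 1 -> S x -> S y ->
    S (t *: x + (1 - t) *: y)) ->
  basic_point a d `<=` S -> halfspaces a d `<=` S.
Proof.
move=> rec Sconv Sb x.
have [N] := ubnP #|~: tight a d x|; elim: N x => // N IH x ltN ax.
have [bx|] := pselect (basic_point a d x); first exact: Sb.
move=> /not_andP [//|] /existsNP [z] /not_implyP [az /eqP z0].
have pos w : w != 0 -> exists k, 0 < dotv (a k) w.
  move=> w0; apply: contrapT => /forallNP h; move/eqP: w0; apply.
  by apply: rec => i; rewrite leNgt; apply/negP/h.
have [k1 zk1] := pos _ z0.
have [|k2 zk2] := pos (- z); first by rewrite oppr_eq0.
have [s1 [s10 as1 t1]] := step_to_tight ax az zk1.
have [|s2 [s20 as2 t2]] := step_to_tight ax _ zk2.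
  by move=> i it; rewrite dotvNr az // oppr0.
have IH' y : tight a d x \proper tight a d y -> halfspaces a d y -> S y.
  move=> pr; apply: IH; rewrite -ltnS; apply: leq_trans ltN.
  by rewrite ltnS; apply: proper_card; rewrite properE !finset.setCS -properE.
have -> : x = (s2 / (s1 + s2)) *: (x + s1 *: z) +
    (1 - s2 / (s1 + s2)) *: (x + s2 *: - z).
  by apply/colP => i; rewrite !mxE; field; lra.
apply: Sconv; [|..|exact: IH'|exact: IH'].
  by rewrite divr_ge0 ?addr_ge0 // ltW.
by rewrite ler_pdivrMr ?addr_gt0 // mul1r lerDr ltW.
Qed.

Lemma basic_point_inj (R : realType) (I : finType) n (a : I -> 'cV[R]_n)
    (d : I -> R) x y :
  basic_point a d x -> basic_point a d y -> tight a d x = tight a d y -> x = y.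
Proof.
move=> [_ xb] _ txy; apply/eqP; rewrite -subr_eq0; apply/eqP.
apply: xb => i it; rewrite dotvBr (tightP it).
by move: it; rewrite txy => /tightP ->; rewrite subrr.
Qed.

(** There is at most one basic point for each tight set. *)
Lemma finite_basic_points (R : realType) (I : finType) n (a : I -> 'cV[R]_n)
    (d : I -> R) :
  exists s : seq 'cV[R]_n, forall x, x \in s <-> basic_point a d x.
Proof.
pose Q (T : {set I}) x := basic_point a d x /\ tight a d x = T.
pose f T := if pselect (exists x, Q T x) is left e then Some (sval (cid e))
            else None.
exists (pmap f (enum {set I})) => x; rewrite mem_pmap; split.
  move=> /mapP [T _]; rewrite /f; case: pselect => // e [->].
  by case: (cid e) => y [].
move=> bx; apply/mapP; exists (tight a d x); first by rewrite mem_enum.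
rewrite /f; case: pselect => [e|[]]; last by exists x.
by case: (cid e) => y [/= yb ty]; congr Some; exact: basic_point_inj bx yb _.
Qed.

Lemma convex_hull_seq_conv (R : realType) n (s : seq 'cV[R]_n) x y t :
  0 <= t -> t <= 1 -> convex_hull_seq s x -> convex_hull_seq s y ->
  convex_hull_seq s (t *: x + (1 - t) *: y).
Proof.
move=> t0 t1 [w [w0 w1 ->]] [w' [w'0 w'1 ->]].
exists (fun i => t * w i + (1 - t) * w' i); split.
- by move=> i; rewrite addr_ge0 // mulr_ge0 // subr_ge0.
- by rewrite big_split -!mulr_sumr w1 w'1 /=; ring.
- rewrite !scaler_sumr -big_split; apply: eq_bigr => i _ /=.
  by rewrite !scalerA -scalerDl.
Qed.

Lemma mem_convex_hull_seq (R : realType) n (s : seq 'cV[R]_n) x :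
  x \in s -> convex_hull_seq s x.
Proof.
move=> xs; have lt : (index x s < size s)%N by rewrite index_mem.
exists (fun i => (i == Ordinal lt)%:R); split.
- by move=> i; rewrite ler0n.
- by rewrite (bigD1 (Ordinal lt)) //= eqxx big1 ?addr0 // => i /negbTE ->.
- rewrite (bigD1 (Ordinal lt)) //= eqxx scale1r big1 ?addr0 ?nth_index //.
  by move=> i /negbTE ->; rewrite scale0r.
Qed.

Lemma convex_hull_seq_le (R : realType) n (s : seq 'cV[R]_n) u r :
  (forall x, x \in s -> dotv u x <= r) ->
  forall x, convex_hull_seq s x -> dotv u x <= r.
Proof.
move=> sr _ [w [w0 w1 ->]]; rewrite dotv_sumr -[r]mul1r -w1 mulr_suml.
apply: ler_sum => i _; rewrite dotvZr ler_wpM2l //.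
exact: sr (mem_nth _ _).
Qed.

(** Minkowski's theorem for bounded polyhedra. *)
Lemma halfspaces_hull (R : realType) (I : finType) n (a : I -> 'cV[R]_n)
    (d : I -> R) :
  trivial_recession a ->
  exists2 s : seq 'cV[R]_n, halfspaces a d = convex_hull_seq s &
    forall x, x \in s -> basic_point a d x.
Proof.
move=> rec; have [s sb] := finite_basic_points a d.
exists s => [|x /sb //]; apply/seteqP; split.
  apply: (@halfspaces_ind _ _ _ a d _ rec).
    by move=> *; exact: convex_hull_seq_conv.
  by move=> x /sb; exact: mem_convex_hull_seq.
move=> x hx i; apply: convex_hull_seq_le hx => y /sb [ya _]; exact: ya.
Qed.

(** The sum of the tight rows is maximal at x only. *)
Lemma basic_point_vertex (R : realType) (I : finType) n (a : I -> 'cV[R]_n)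
    (d : I -> R) x :
  basic_point a d x -> vertex (halfspaces a d) x.
Proof.
move=> [ax bx]; split; first by exists x.
exists (\sum_(i in tight a d x) a i).
have le y : halfspaces a d y -> dotv (\sum_(i in tight a d x) a i) y <=
    dotv (\sum_(i in tight a d x) a i) x.
  move=> ay; rewrite !dotv_suml ler_sum // => i it.
  by rewrite (tightP it); exact: ay.
apply/seteqP; split => [_ -> //|y [ay /(_ _ ax) ly]] /=.
apply/eqP; rewrite -subr_eq0; apply/eqP; apply: bx => i it.
have h0 : \sum_(j in tight a d x) (dotv (a j) x - dotv (a j) y) = 0.
  by rewrite sumrB -!dotv_suml; apply/eqP; rewrite subr_eq0 eq_le ly le.
move/eqP: h0; rewrite psumr_eq0 => [/allP|j jt]; last first.
  by rewrite subr_ge0 (tightP jt); exact: ay.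
move=> /(_ i (mem_index_enum i)); rewrite it /= => /eqP h.
by rewrite dotvBr -opprB h oppr0.
Qed.

(** A direction in the common kernel of the tight rows can be followed both
    ways, which a unique maximum excludes. *)
Lemma vertex_basic_point (R : realType) (I : finType) n (a : I -> 'cV[R]_n)
    (d : I -> R) v :
  vertex (halfspaces a d) v -> basic_point a d v.
Proof.
move=> [_ [u uE]].
have : [set v] v by [].
rewrite uE => -[av vmax]; split => // z az.
have half w : (forall i, i \in tight a d v -> dotv (a i) w = 0) ->
    dotv u w <= 0 /\ (0 <= dotv u w -> w = 0).
  move=> aw; have [i /aw -> //|e e0 ae] := @small_step _ _ _ a d v w av.
  have := vmax _ ae; rewrite dotvDr dotvZr gerDl pmulr_rle0 // => uw.
  split => // uw'; have : [set v] (v + e *: w).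
    rewrite uE; split => // y /vmax h; rewrite dotvDr dotvZr.
    by rewrite (le_trans h) // lerDl mulr_ge0 // ltW.
  move=> /= /eqP; rewrite -subr_eq0 addrAC subrr add0r scaler_eq0.
  by rewrite gt_eqF //= => /eqP.
have [uz zz] := half _ az.
have [|uz' _] := half (- z).
  by move=> i /az; rewrite dotvNr => ->; rewrite oppr0.
by apply: zz; rewrite -oppr_le0 -dotvNr.
Qed.

Lemma max_at_vertex (R : realType) (I : finType) n (a : I -> 'cV[R]_n)
    (d : I -> R) u :
  trivial_recession a -> halfspaces a d !=set0 ->
  exists2 v, vertex (halfspaces a d) v &
    forall y, halfspaces a d y -> dotv u y <= dotv u v.
Proof.
move=> rec [x0 ax0]; have [s sE sb] := halfspaces_hull d rec.
case: s => [|x1 s] in sE sb *.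
  move: ax0; rewrite sE => -[w [_ /eqP]]; rewrite big_ord0 eq_sym.
  by rewrite oner_eq0.
set S := x1 :: s in sE sb.
case: (@arg_maxP _ _ 'I_(size S) ord0 predT (fun i => dotv u S`_i) isT).
move=> i _ im; exists S`_i.
  by apply: basic_point_vertex; apply/sb/mem_nth.
rewrite sE; apply: convex_hull_seq_le => y /(nthP 0) [j jS <-].
exact: (im (Ordinal jS)).
Qed.

Lemma face_has_vertex (R : realType) (I : finType) n (a : I -> 'cV[R]_n)
    (d : I -> R) F :
  trivial_recession a -> face (halfspaces a d) F ->
  exists2 v, vertex (halfspaces a d) v & F v.
Proof.
move=> rec [[x Fx] [u FE]]; move: Fx; rewrite FE => -[ax xm].
have [v vv vm] := @max_at_vertex _ _ _ a d u rec (ex_intro _ x ax).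
by exists v => //; split => //; have [] := vertex_basic_point vv.
Qed.

(** * Integer vectors *)

Lemma real_mxZ (R : realType) m n k (A : 'M[int]_(m, n)) :
  real_mx R (k *: A) = k%:~R *: real_mx R A.
Proof. by apply/matrixP => i j; rewrite /real_mx !mxE rmorphM. Qed.

Lemma real_mxD (R : realType) m n (A B : 'M[int]_(m, n)) :
  real_mx R (A + B) = real_mx R A + real_mx R B.
Proof. by apply/matrixP => i j; rewrite /real_mx !mxE rmorphD. Qed.

Lemma real_mxN (R : realType) m n (A : 'M[int]_(m, n)) :
  real_mx R (- A) = - real_mx R A.
Proof. by apply/matrixP => i j; rewrite /real_mx !mxE rmorphN. Qed.

Lemma real_mx0 (R : realType) m n : real_mx R (0 : 'M[int]_(m, n)) = 0.
Proof. by apply/matrixP => i j; rewrite /real_mx !mxE. Qed.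

Lemma real_mx_sum (R : realType) m n (I : Type) (r : seq I) (P : pred I)
    (F : I -> 'M[int]_(m, n)) :
  real_mx R (\sum_(i <- r | P i) F i) = \sum_(i <- r | P i) real_mx R (F i).
Proof.
exact: (big_morph (@real_mx R m n) (@real_mxD R m n) (@real_mx0 R m n)).
Qed.

Lemma real_mx_inj (R : realType) m n : injective (@real_mx R m n).
Proof.
move=> A B /matrixP AB; apply/matrixP => i j.
by have := AB i j; rewrite /real_mx !mxE => /intr_inj.
Qed.

Lemma primitive_scale n k (w : 'cV[int]_n) :
  primitive (k *: w) -> `|k|%N = 1%N.
Proof.
move=> kw; apply/eqP; rewrite -dvdn1 -kw; apply/dvdn_biggcdP => i _.
by rewrite mxE abszM dvdn_mulr.
Qed.

Lemma primitive_dot n (a z : 'cV[int]_n) : dotz a z = 1 -> primitive z.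
Proof.
move=> az; apply/eqP; rewrite -dvdn1.
set g := \big[gcdn/0%N]_i _.
suff : (g%:Z %| dotz a z)%Z by rewrite az dvdzE.
rewrite dotzE; apply: rpred_sum => i _; apply: dvdz_mull.
by rewrite dvdzE /= /g; exact: (@biggcdn_inf _ i).
Qed.

Lemma primitive_neq0 (R : realType) n (z : 'cV[int]_n) :
  primitive z -> real_mx R z != 0.
Proof.
move=> pz; apply/eqP => z0; move: pz.
have -> : z = 0 *: 0 by apply: (@real_mx_inj R); rewrite scale0r real_mx0.
by move=> /primitive_scale.
Qed.

Lemma primitive_multiple n (z : 'cV[int]_n) :
  z != 0 -> exists2 g : nat, (0 < g)%N & exists2 w, primitive w & z = g%:Z *: w.
Proof.
move=> z0; pose g := \big[gcdn/0%N]_(i < n) `|(z i 0)%R|%N.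
have gz i : (g %| `|(z i 0)%R|)%N by exact: (@biggcdn_inf _ i).
have g0 : (0 < g)%N.
  rewrite lt0n; apply: contra z0 => /eqP g0; apply/eqP/colP => i.
  by have := gz i; rewrite g0 dvd0n mxE absz_eq0 => /eqP.
exists g => //; pose w := \col_i ((z i 0)%R %/ g)%Z.
have zw : z = g%:Z *: w.
  by apply/colP => i; rewrite !mxE mulrC divzK // dvdzE.
exists w => //; apply/eqP; rewrite -dvdn1.
set h := \big[gcdn/0%N]_i _.
have : (g * h %| g)%N.
  rewrite {2}/g; apply/dvdn_biggcdP => i _; rewrite zw mxE abszM dvdn_mul //.
  exact: (@biggcdn_inf _ i).
by rewrite -{2}[g]muln1 dvdn_pmul2l.
Qed.

(** * Unimodular presentations *)

Definition dual_family (I : finType) n (a : I -> 'cV[int]_n) (T : {set I})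
    (u : I -> 'cV[int]_n) : Prop :=
  forall i j, i \in T -> j \in T -> dotz (a i) (u j) = (i == j)%:R.

Section RealPresentation.
Variables (R : realType) (I : finType) (n : nat).
Variables (a : I -> 'cV[int]_n) (d : I -> int).

Definition real_rows (i : I) : 'cV[R]_n := real_mx R (a i).
Definition real_bounds (i : I) : R := (d i)%:~R.

(** Halfspace form of a smooth lattice polytope: at a vertex, the dual vectors
    are the opposites of the primitive edge vectors. As every tight set is
    contained in the tight set of a vertex, it is no restriction to ask for dual
    vectors at all the points, and this form is the easiest to transport along
    projections and products. *)
Definition unimodular_presentation : Prop :=
  trivial_recession real_rows /\
  forall x, halfspaces real_rows real_bounds x ->
    exists u, dual_family a (tight real_rows real_bounds x) u.

End RealPresentation.

Definition subface (R : realType) (I : finType) n (a : I -> 'cV[R]_n)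
    (d : I -> R) (S : {set I}) : set 'cV[R]_n :=
  [set x | halfspaces a d x /\ forall j, j \in S -> dotv (a j) x = d j].

(** The sum of the rows in S is maximal exactly where they are all tight. *)
Lemma subface_face (R : realType) (I : finType) n (a : I -> 'cV[R]_n)
    (d : I -> R) (S : {set I}) :
  subface a d S !=set0 -> face (halfspaces a d) (subface a d S).
Proof.
move=> S0; have [v [av Sv]] := S0; split=> //.
exists (\sum_(j in S) a j).
have le y : halfspaces a d y ->
    dotv (\sum_(j in S) a j) y <= \sum_(j in S) d j.
  by move=> ay; rewrite dotv_suml ler_sum // => j _; exact: ay.
apply/seteqP; split => [x [ax Sx]|x [ax xm]].
  split => // y /le /le_trans; apply.
  by rewrite dotv_suml ler_sum // => j /Sx ->.
split => // j jS.
have := xm _ av; rewrite !dotv_suml.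
rewrite (eq_bigr _ Sv) => h.
have : \sum_(j in S) (d j - dotv (a j) x) == 0.
  by rewrite sumrB subr_eq0 eq_le h /= -dotv_suml le.
rewrite psumr_eq0 => [/allP/(_ j (mem_index_enum j))|k _]; last first.
  by rewrite subr_ge0; exact: ax.
by rewrite jS subr_eq0 => /eqP.
Qed.

Lemma setD_setD1 (I : finType) (T : {set I}) i :
  i \in T -> T :\: (T :\ i) = [set i]%SET.
Proof.
move=> iT; rewrite finset.setDDr finset.setDv finset.set0U.
by apply/finset.setIidPr; rewrite finset.sub1set.
Qed.

Lemma dual_family_real (R : realType) (I : finType) n (a : I -> 'cV[int]_n)
    (T : {set I}) u i j :
  dual_family a T u -> i \in T -> j \in T ->
  dotv (@real_rows R _ _ a i) (real_mx R (u j)) = (i == j)%:R.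
Proof. by move=> du iT jT; rewrite dotv_real du //; case: eqP. Qed.

Section VertexCone.
Variables (R : realType) (I : finType) (n : nat).
Variables (a : I -> 'cV[int]_n) (d : I -> int).
Variables (v : 'cV[R]_n) (u : I -> 'cV[int]_n).
Let A := @real_rows R I n a.
Let D := @real_bounds R I d.
Let U i := real_mx R (u i).
Let T := tight A D v.
Hypothesis bv : basic_point A D v.
Hypothesis du : dual_family a T u.

(** Both sides agree on the tight rows, and these have no common kernel at a
    vertex: the dual family is a basis. *)
Lemma dual_expansion x : x = \sum_(i in T) dotv (A i) x *: U i.
Proof.
apply/eqP; rewrite -subr_eq0; apply/eqP; apply: bv.2 => j jT.
rewrite dotvBr dotv_sumr (bigD1 j) //= dotvZr.
  rewrite (dual_family_real R du) // eqxx mulr1.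
rewrite big1 ?addr0 ?subrr // => i /andP[iT /negbTE ij].
by rewrite dotvZr (dual_family_real R du) // eq_sym ij mulr0.
Qed.

(** Both cardinals are the trace of the identity, written in the coordinates
    and in the basis of dual vectors. *)
Lemma card_tight : #|T| = n.
Proof.
apply/eqP; rewrite -(eqr_nat R); apply/eqP.
have e k : \sum_(i in T) A i k 0 * U i k 0 = 1.
  have := congr1 (fun x : 'cV[R]_n => x k 0) (dual_expansion (delta_mx k 0)).
  rewrite summxE mxE !eqxx => h; rewrite -[1]/((true && true)%:R) h.
  apply: eq_bigr => i _.
  rewrite !mxE dotvE (bigD1 k) //= big1 => [|j /negbTE jk]; last first.
    by rewrite !mxE jk /= mulr0.
  by rewrite addr0 !mxE !eqxx mulr1.
have : \sum_(k < n) \sum_(i in T) A i k 0 * U i k 0 = n%:R.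
  by rewrite (eq_bigr _ (fun k _ => e k)) sumr_const card_ord.
rewrite exchange_big /= => <-.
rewrite -sum1_card natr_sum; apply: eq_bigr => i iT.
by rewrite -dotvE (dual_family_real R du) // eqxx.
Qed.

Lemma tight_enumeration :
  exists2 s : 'I_n -> I, injective s & forall i, i \in T <-> exists k, s k = i.
Proof.
exists (fun k => enum_val (cast_ord (esym card_tight) k)).
  by move=> k l /enum_val_inj /cast_ord_inj.
move=> i; split => [iT|[k <-]]; last exact: enum_valP.
exists (cast_ord card_tight (enum_rank_in iT i)).
by rewrite cast_ordK enum_rankK_in.
Qed.

Lemma vertex_edge_step i : i \in T ->
  exists2 e : R, 0 < e & halfspaces A D (v + e *: - U i).
Proof.
move=> iT; apply: small_step; first exact: bv.1.
by move=> j jT; rewrite dotvNr (dual_family_real R du) // oppr_le0 ler0n.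
Qed.

(** A functional that is maximal at v is a nonnegative combination of the tight
    rows; its face is cut out by the rows that really occur in it. *)
Lemma face_at_vertex F : face (halfspaces A D) F -> F v ->
  exists2 S : {set I}, S \subset T & F = subface A D S.
Proof.
move=> [_ [c FE]] Fv; have [av vm] : halfspaces A D v /\
    forall y, halfspaces A D y -> dotv c y <= dotv c v by move: Fv; rewrite FE.
pose S := [set j in T | dotv c (U j) != 0].
have cU j : j \in T -> 0 <= dotv c (U j).
  move=> /vertex_edge_step [e e0 /vm].
  by rewrite dotvDr dotvZr dotvNr gerDl mulrN oppr_le0 pmulr_rge0.
have drop x : dotv c v - dotv c x =
    \sum_(i in T) (D i - dotv (A i) x) * dotv c (U i).
  rewrite -dotvBr [v - x]dual_expansion dotv_sumr; apply: eq_bigr => i iT.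
  by rewrite dotvZr dotvBr (tightP iT).
exists S; first by apply/fintype.subsetP => i; rewrite inE => /andP[].
rewrite FE; apply/seteqP; split => [x [ax xm]|x [ax xS]]; split => //.
  move=> j; rewrite inE => /andP[jT jc].
  have : \sum_(i in T) (D i - dotv (A i) x) * dotv c (U i) == 0.
    rewrite -drop eq_le subr_le0 xm //= drop sumr_ge0 // => i iT.
    by rewrite mulr_ge0 ?cU // subr_ge0; exact: ax.
  rewrite psumr_eq0 => [/allP/(_ j (mem_index_enum j))|i iT]; last first.
    by rewrite mulr_ge0 ?cU // subr_ge0; exact: ax.
  by rewrite jT mulf_eq0 (negbTE jc) orbF subr_eq0 eq_sym => /eqP.
move=> y /vm h; apply: (le_trans h); rewrite -subr_le0 drop big1 // => i iT.
have [->|ci] := eqVneq (dotv c (U i)) 0; first by rewrite mulr0.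
by rewrite xS ?subrr ?mul0r // inE iT.
Qed.

Lemma vertex_in_subface (S : {set I}) : S \subset T -> subface A D S v.
Proof.
move=> /fintype.subsetP ST; split; first exact: bv.1.
by move=> j /ST /tightP.
Qed.

Lemma subface_edge_step (S : {set I}) i : S \subset T -> i \in T :\: S ->
  exists2 e : R, 0 < e & subface A D S (v + e *: - U i).
Proof.
move=> /fintype.subsetP ST; rewrite inE => /andP[iS iT].
have [e e0 ae] := vertex_edge_step iT; exists e => //; split => // j jS.
rewrite dotvDr dotvZr dotvNr (dual_family_real R du) ?(ST j) //.
rewrite (tightP (ST _ jS)).
by case: eqP jS iS => [->->|_ _ _] //=; rewrite oppr0 mulr0 addr0.
Qed.

Lemma subface_sub (S : {set I}) x y :
  subface A D S x -> subface A D S y -> S \subset T ->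
  y - x = \sum_(i in T :\: S) dotv (A i) (y - x) *: U i.
Proof.
move=> [_ xS] [_ yS] /finset.setIidPr ST.
rewrite {1}[y - x]dual_expansion (big_setID S) /= ST big1 ?add0r // => i iS.
by rewrite dotvBr xS // yS // subrr scale0r.
Qed.

(** The dual vectors outside of S are edge directions of the subface, and they
    span its direction space. *)
Lemma subface_dim (S : {set I}) e :
  S \subset T -> affine_dim (subface A D S) e -> e = #|T :\: S|.
Proof.
move=> ST [x0 [V [Sx0 SV rV Sw]]]; set k := #|_|.
pose W := \matrix_(i < n, j < k) U (enum_val j) i 0.
pose B := \matrix_(j < k, i < n) A (enum_val j) i 0.
have colB i j : (B *m col i V) j 0 = dotv (A (enum_val j)) (col i V).
  by rewrite dotvE mxE; apply: eq_bigr => l _; rewrite mxE.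
have BW : B *m W = 1%:M.
  apply/matrixP => i j; rewrite !mxE.
  have := @dual_family_real R _ _ _ _ _ (enum_val i) (enum_val j) du.
  have := enum_valP i; have := enum_valP j.
  rewrite !inE => /andP[_ jT] /andP[_ iT] /(_ iT jT).
  rewrite dotvE (inj_eq enum_val_inj) => <-.
  by apply: eq_bigr => l _; rewrite !mxE.
apply/eqP; rewrite eqn_leq; apply/andP; split.
  rewrite -rV; have -> : V = W *m (B *m V).
    apply/matrixP => i j.
    have -> : (W *m (B *m V)) i j = (W *m (B *m col j V)) i 0.
      rewrite mxE [RHS]mxE; apply: eq_bigr => l _; congr (_ * _).
      by rewrite mxE [RHS]mxE; apply: eq_bigr => k' _; rewrite !mxE.
    have -> : V i j = (x0 + col j V - x0) i 0 by rewrite addrAC subrr add0r mxE.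
    rewrite (subface_sub Sx0 (SV j) ST) addrAC subrr add0r summxE mxE.
    rewrite big_enum_val; apply: eq_bigr => l _.
    by rewrite colB !mxE mulrC.
  exact: leq_trans (mxrankM_maxl _ _) (rank_leq_col _).
have /(_ _)/cid-/all_sig [X WX] : forall j, exists x, col j W = V *m x.
  move=> j; have jT := enum_valP j.
  have [r r0 /Sw [w2 E2]] := subface_edge_step ST jT.
  have [w1 E1] := Sw _ (vertex_in_subface ST).
  exists (r^-1 *: (w1 - w2)); rewrite -scalemxAr mulmxBr.
  have -> : V *m w1 - V *m w2 = r *: U (enum_val j).
    transitivity (v - (v + r *: - U (enum_val j))).
      by rewrite E2 {1}E1 opprD addrACA subrr add0r.
    by rewrite opprD addrA subrr add0r scalerN opprK.
  rewrite scalerA mulVf ?gt_eqF // scale1r.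
  by apply/colP => i; rewrite !mxE.
have : (B *m V) *m (\matrix_(i, j) X j i 0) = 1%:M.
  rewrite -mulmxA -BW; congr (_ *m _); apply/matrixP => i j.
  have := congr1 (fun x : 'cV[R]_n => x i 0) (WX j); rewrite !mxE => ->.
  by apply: eq_bigr => l _; rewrite !mxE.
exact: mulmx1_min.
Qed.

Lemma edge_at_vertex E : edge (halfspaces A D) E /\ E v <->
  exists2 i, i \in T & E = subface A D (T :\ i).
Proof.
split => [[[fE dE] Ev]|[i iT ->]].
  have [S ST ES] := face_at_vertex fE Ev.
  have := subface_dim ST; rewrite -ES => /(_ _ dE)/esym/eqP/cards1P [i Ti].
  have : i \in T :\: S by rewrite Ti inE.
  rewrite inE => /andP[_ iT].
  exists i => //; rewrite ES; congr (subface A D _); rewrite -Ti.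
  rewrite finset.setDDr finset.setDv finset.set0U.
  exact/esym/finset.setIidPr.
have sT : T :\ i \subset T by exact: finset.subD1set.
have vS := vertex_in_subface sT.
have TS := setD_setD1 iT.
split => //; split; first by apply: subface_face; exists v.
have [|e e0 ve] := @subface_edge_step _ i sT; first by rewrite TS inE.
exists v, (e *: - U i); split => //.
- move=> j; suff -> : col j (e *: - U i) = e *: - U i by [].
  by apply/colP => l; rewrite !mxE (ord1 j).
- rewrite -mxrank_tr rank_rV trmx_eq0 scaler_eq0 gt_eqF //= oppr_eq0.
  suff -> : U i != 0 by [].
  apply/eqP => U0; have := dual_family_real R du iT iT.
  by rewrite -/(U i) U0 dotv0r eqxx => /eqP; rewrite eq_sym oner_eq0.
- move=> x Sx; exists (- e^-1 * dotv (A i) (x - v))%:M.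
  have := subface_sub vS Sx sT; rewrite TS big_set1 => xv.
  rewrite mul_mx_scalar scalerA scalerN -scaleNr -[LHS](subrK v) addrC {1}xv.
  by congr (_ + _ *: _); field; rewrite gt_eqF.
Qed.

Lemma primitive_edges_at_vertex :
  primitive_edge_vectors (halfspaces A D) v =
  [set - u i | i in [set i | i \in T]].
Proof.
apply/seteqP; split => z.
  move=> [pz [E [eE Ev [t t0 Et]]]].
  have [i iT Ei] := (edge_at_vertex E).1 (conj eE Ev); move: Ev Et.
  rewrite Ei => vS zS; have sT : T :\ i \subset T by exact: finset.subD1set.
  have TS := setD_setD1 iT.
  have := subface_sub vS zS sT; rewrite TS big_set1 addrAC subrr add0r.
  rewrite dotvZr -scalerA => /(scalerI (lt0r_neq0 t0)).
  rewrite /A /U dotv_real -real_mxZ => /real_mx_inj zE.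
  have : dotz (a i) z <= 0.
    have := zS.1 i; rewrite dotvDr (tightP iT) dotvZr gerDl pmulr_rle0 //.
    by rewrite dotv_real -[0]/(0%:~R) ler_int.
  have : `|dotz (a i) z|%N = 1%N.
    by apply: (@primitive_scale _ _ (u i)); rewrite -zE.
  case: (dotz (a i) z) zE => [[|[|k]]|[|k]] //= -> _ _.
  by exists i => //; rewrite scaleN1r.
move=> [i iT <-]; split.
  apply: (@primitive_dot _ (- a i)); have := du iT iT.
  rewrite eqxx => h; apply: etrans h.
  by rewrite !dotzE; apply: eq_bigr => k _; rewrite !mxE mulrNN.
have sT : T :\ i \subset T by exact: finset.subD1set.
exists (subface A D (T :\ i)).
have [eE Ev] := (edge_at_vertex _).2 (ex_intro2 _ _ i iT erefl).
split => //.
have [|e e0 ve] := @subface_edge_step _ i sT.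
  by rewrite setD_setD1 // inE.
by exists e => //; rewrite real_mxN.
Qed.

Lemma integral_vertex : integer_points v.
Proof.
exists (\sum_(i in T) d i *: u i) => //; rewrite real_mx_sum [v]dual_expansion.
by apply: eq_bigr => i iT; rewrite real_mxZ (tightP iT).
Qed.

Lemma Zbasis_at_vertex (s : 'I_n -> I) :
  injective s -> (forall i, i \in T <-> exists k, s k = i) ->
  Zbasis (fun k => - u (s k)).
Proof.
move=> si sT z.
have sTk k : s k \in T by apply/sT; exists k.
have sumT (V : nmodType) (F : I -> V) : \sum_(i in T) F i = \sum_k F (s k).
  rewrite (reindex_omap s (fun i => [pick k | s k == i])) /=.
    apply: eq_bigl => k; rewrite sTk /=.
    by case: pickP => [l /eqP /si ->|/(_ k)]; rewrite eqxx.
  by move=> i /sT [k <-]; case: pickP => [l /eqP /= ->|/(_ k)]; rewrite ?eqxx.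
exists (\col_k - dotz (a (s k)) z); split.
  apply: (@real_mx_inj R); rewrite [LHS]dual_expansion sumT real_mx_sum.
  apply: eq_bigr => k _.
  by rewrite real_mxZ real_mxN mxE dotv_real scalerN rmorphN scaleNr opprK.
move=> w zE; apply/colP => k; rewrite mxE; apply/eqP.
rewrite eqr_oppLR -(inj_eq (@intr_inj R)) -dotv_real zE real_mx_sum dotv_sumr.
rewrite (bigD1 k) //= real_mxZ real_mxN dotvZr dotvNr.
rewrite (dual_family_real R du) //.
rewrite eqxx big1 ?addr0 ?mulrN1 ?rmorphN // => l /negbTE lk.
rewrite real_mxZ real_mxN dotvZr dotvNr (dual_family_real R du) // (inj_eq si).
by rewrite eq_sym lk oppr0 mulr0.
Qed.

(** The edges are told apart by their tight rows: moving along the edge that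
    loosens one row leaves any edge on which this row stays tight. *)
Lemma simple_at_vertex :
  ([set E | edge (halfspaces A D) E /\ E v] #= `I_n)%card.
Proof.
have [s si sT] := tight_enumeration.
have sTk k : s k \in T by apply/sT; exists k.
have -> : [set E | edge (halfspaces A D) E /\ E v] =
    [set subface A D (T :\ s k) | k in [set: 'I_n]].
  apply/seteqP; split => E.
    by move=> /edge_at_vertex [i /sT [k <-] ->]; exists k.
  by move=> [k _ <-]; apply/edge_at_vertex; exists (s k).
apply: (card_eq_trans (inj_card_eq _)); last by rewrite card_eq_sym card_II.
move=> k l _ _ kl; apply/eqP/contraT => nkl.
have [|e e0 []] := @subface_edge_step (T :\ s k) (s k) (finset.subD1set _ _).
  by rewrite setD_setD1 ?sTk // inE.
move=> ae _; have : subface A D (T :\ s l) (v + e *: - U (s k)).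
  rewrite -kl; split => // j; rewrite in_setD1 => /andP[jk jT].
  rewrite dotvDr dotvZr dotvNr (dual_family_real R du) // (negbTE jk).
  by rewrite oppr0 mulr0 addr0 (tightP jT).
move=> [_ /(_ (s k))]; rewrite in_setD1 (inj_eq si) nkl /= => /(_ (sTk k)).
rewrite dotvDr dotvZr dotvNr (dual_family_real R du) // eqxx (tightP (sTk k)).
by move=> /eqP; rewrite -subr_eq0 addrAC subrr add0r mulrN1 oppr_eq0 gt_eqF.
Qed.

End VertexCone.

(** * Polytopes with a unimodular presentation *)

Lemma halfspaces_interior (R : realType) (I : finType) n (a : I -> 'cV[R]_n)
    (d : I -> R) : (forall i, 0 < d i) -> interior (halfspaces a d) 0.
Proof.
move=> d0; suff /filter_forall : forall i,
    \forall x \near (0 : 'cV[R]_n), dotv (a i) x <= d i by apply.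
move=> i.
have c : continuous (dotv (a i)).
  have -> : dotv (a i) = fun x => \sum_k a i k 0 * x k 0.
    by apply/funext => x; rewrite dotvE.
  apply: (@continuous_big R 'I_n +%R 0 xpredT (@add_continuous R) 'cV[R]_n _
    (fun k x => a i k 0 * x k 0)) => k _ x.
  apply: (continuous_comp (coord_continuous (x:=x))).
  exact: mulrl_continuous.
by have := cvgr_le _ (c 0) (d i); rewrite dotv0r; apply.
Qed.

Section UnimodularPolytope.
Variables (R : realType) (I : finType) (n : nat).
Variables (a : I -> 'cV[int]_n) (d : I -> int).
Let A := @real_rows R I n a.
Let D := @real_bounds R I d.
Let Q := halfspaces A D.
Hypothesis uni : unimodular_presentation R a d.

Lemma unimodular_vertex v : vertex Q v ->
  basic_point A D v /\ exists u, dual_family a (tight A D v) u.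
Proof.
by move=> /vertex_basic_point bv; split => //; apply: uni.2; exact: bv.1.
Qed.

Lemma unimodular_polytope : polytope Q.
Proof. by have [s Qs _] := halfspaces_hull D uni.1; exists s. Qed.

Lemma unimodular_lattice : lattice_polytope Q.
Proof.
split; first exact: unimodular_polytope.
by move=> v /unimodular_vertex [bv [u du]]; exact: integral_vertex bv du.
Qed.

Lemma unimodular_rational : rational_polytope Q.
Proof.
move=> E eE; have [v vv Ev] := face_has_vertex uni.1 eE.1.
have [bv [u du]] := unimodular_vertex vv.
have [i iT EE] := (edge_at_vertex bv du E).1 (conj eE Ev).
exists (u i); split.
  apply/eqP => u0; have := dual_family_real R du iT iT.
  by rewrite u0 dotv0r eqxx => /eqP; rewrite eq_sym oner_eq0.
rewrite EE => x y xE yE; exists (dotv (A i) (y - x)).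
rewrite {1}(subface_sub bv du xE yE) ?finset.subD1set //.
by rewrite setD_setD1 // big_set1.
Qed.

Hypothesis d_gt0 : forall i, 0 < d i.

Lemma unimodular_full_dim : affine_dim Q n.
Proof.
have Q0 : Q 0 by move=> i; rewrite dotv0r ler0z ltW.
have /(_ _)/cid-/all_sig [e eP] : forall k, exists e : R,
    0 < e /\ Q (e *: delta_mx k 0).
  move=> k; have [i|e e0 Qe] := @small_step _ _ _ A D 0 (delta_mx k 0) Q0.
    rewrite inE dotv0r => /eqP/esym/eqP; rewrite intr_eq0 => /eqP di0.
    by have := d_gt0 i; rewrite di0 ltxx.
  by exists e; split => //; rewrite add0r in Qe.
pose V := diag_mx (\row_k e k).
have uV : V \in unitmx.
  rewrite unitmxE det_diag unitfE prodf_seq_neq0; apply/allP => k _ /=.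
  by rewrite mxE gt_eqF //; case: (eP k).
exists 0, V; split => //.
- move=> j; rewrite add0r.
  suff -> : col j V = e j *: delta_mx j 0 by case: (eP j).
  apply/colP => i; rewrite !mxE eqxx andbT.
  by case: eqP => [->|] //=; rewrite ?mulr1 ?mulr0.
- exact: mxrank_unit.
- by move=> x _; exists (invmx V *m x); rewrite add0r mulKVmx.
Qed.

(** Smoothness is local at the vertices, except for the full dimension, which
    holds because no row is tight at the origin. *)
Lemma unimodular_smooth : smooth_polytope Q.
Proof.
split; first exact: unimodular_polytope.
- exact: unimodular_full_dim.
- move=> v /unimodular_vertex [bv [u du]]; exact: simple_at_vertex bv du.
- exact: unimodular_rational.
- move=> v /unimodular_vertex [bv [u du]].
  have [s si sT] := tight_enumeration bv du.
  exists (fun k => - u (s k)); first exact: Zbasis_at_vertex bv du s si sT.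
  rewrite (primitive_edges_at_vertex bv du); apply/seteqP; split => z.
    by move=> [i /sT [k <-] <-]; exists k.
  by move=> [k _ <-]; exists (s k) => //=; apply/sT; exists k.
Qed.

(** A facet has one tight row by the dimension count, and this row is primitive
    because it takes the value 1 on its dual vector. *)
Lemma unimodular_reflexive : (forall i, d i = 1) -> reflexive_polytope Q.
Proof.
move=> d1; split; first exact: unimodular_lattice.
  by apply: halfspaces_interior => i; rewrite ltr0z.
move=> F [fF [e en dF]]; have [v vv Fv] := face_has_vertex uni.1 fF.
have [bv [u du]] := unimodular_vertex vv.
have [S ST FS] := face_at_vertex bv du fF Fv.
have /cards1P [i Si] : #|S| == 1%N.
  have := subface_dim bv du ST; rewrite -FS => /(_ _ dF).
  have cT : #|tight A D v| = n := card_tight bv du.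
  have := subset_leq_card ST; rewrite cT => Sn.
  rewrite cardsD (finset.setIidPr ST) cT => eE.
  by apply/eqP; rewrite -(subKn Sn) -eE -en subSnn.
have iT : i \in tight A D v by apply: (fintype.subsetP ST); rewrite Si inE.
exists (a i).
  by apply: (@primitive_dot _ (u i)); rewrite dotzC du // eqxx.
have Di : D i = 1 by rewrite /D /real_bounds d1.
split => [x xQ|]; first by rewrite /= -Di; exact: xQ.
rewrite FS Si; apply/seteqP; split => x [ax xi]; split => //.
  by rewrite -Di; apply: xi; rewrite inE.
by move=> j; rewrite inE => /eqP ->; exact: etrans xi (esym Di).
Qed.

End UnimodularPolytope.

(** * Facet descriptions of smooth polytopes *)

Lemma polytope_trivial_recession (R : realType) (I : finType) n
    (a : I -> 'cV[R]_n) (d : I -> R) :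
  halfspaces a d !=set0 -> polytope (halfspaces a d) -> trivial_recession a.
Proof.
move=> [x ax] [s Qs] z az; apply: dotv_eq0; apply/eqP; rewrite eq_le.
apply/andP; split; last first.
  by rewrite dotvE sumr_ge0 // => k _; rewrite -expr2 sqr_ge0.
rewrite leNgt; apply/negP => q0.
(* M bounds the functional z on the polytope, t exceeds it along the ray *)
pose M := \sum_(y <- s) `|dotv z y|.
have le y : halfspaces a d y -> dotv z y <= M.
  rewrite Qs; apply: convex_hull_seq_le => {}y ys.
  apply: (le_trans (ler_norm _)).
  by rewrite /M (big_rem y) //= lerDl sumr_ge0.
pose t := (M - dotv z x + 1) / dotv z z.
have t0 : 0 <= t.
  by rewrite divr_ge0 ?(ltW q0) // addr_ge0 // subr_ge0; exact: le.
have : halfspaces a d (x + t *: z).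
  move=> i; rewrite dotvDr dotvZr; have := ax i.
  have : t * dotv (a i) z <= 0 by rewrite mulr_ge0_le0.
  lra.
move=> /le; rewrite dotvDr dotvZr /t divfK ?gt_eqF //; lra.
Qed.

(** A pointed cone is generated by its extreme rays. The slice of the cone by
    the hyperplane on which the sum of the rows is -1 has no direction of
    recession, and its basic points span extreme rays. *)
Lemma cone_extreme_ind (R : realType) (I : finType) n (a : I -> 'cV[R]_n)
    (T : {set I}) (f : 'cV[R]_n) :
  (forall z, (forall i, i \in T -> dotv (a i) z = 0) -> z = 0) ->
  (forall y, (forall i, i \in T -> dotv (a i) y <= 0) -> y != 0 ->
    (forall z, (forall i, i \in T -> dotv (a i) y = 0 -> dotv (a i) z = 0) ->
      exists t, z = t *: y) ->
    0 <= dotv f y) ->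
  forall y, (forall i, i \in T -> dotv (a i) y <= 0) -> 0 <= dotv f y.
Proof.
move=> pointed ext y Cy; pose g := \sum_(i in T) a i.
pose a' (i : I + bool) : 'cV[R]_n := match i with
  | inl i => if i \in T then a i else 0
  | inr true => g | inr false => - g end.
pose d' (i : I + bool) : R := match i with
  | inl _ => 0 | inr true => -1 | inr false => 1 end.
have gT z : (forall i, i \in T -> dotv (a i) z <= 0) -> dotv g z = 0 -> z = 0.
  move=> Cz /eqP gz; apply: pointed => i iT; apply/eqP.
  move: gz; rewrite dotv_suml -oppr_eq0 -sumrN psumr_eq0 => [/allP|j jT].
    by move=> /(_ i (mem_index_enum i)); rewrite iT oppr_eq0.
  by rewrite oppr_ge0 Cz.
have rec : trivial_recession a'.
  move=> z az; apply: gT => [i iT|]; first by have := az (inl i); rewrite /= iT.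
  have := az (inr true); have := az (inr false).
  by rewrite /= dotvNl oppr_le0 => h1 h2; apply/eqP; rewrite eq_le h1 h2.
have coneP z : halfspaces a' d' z ->
    (forall i, i \in T -> dotv (a i) z <= 0) /\ dotv g z = -1.
  move=> az; split => [i iT|]; first by have := az (inl i); rewrite /= iT.
  have := az (inr true); have := az (inr false).
  by rewrite /= dotvNl lerNl => h1 h2; apply/eqP; rewrite eq_le h1 h2.
have slice : halfspaces a' d' `<=` [set z | 0 <= dotv f z].
  apply: (halfspaces_ind rec) => [x z t t0 t1 fx fz|z [/coneP [Cz gz] bz]] /=.
    by rewrite dotvDr !dotvZr addr_ge0 // mulr_ge0 // subr_ge0.
  apply: ext => // [|w Tw].
    apply/eqP => z0; move: gz; rewrite z0 dotv0r => /eqP.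
    by rewrite eq_sym oppr_eq0 oner_eq0.
  exists (- dotv g w); apply/eqP; rewrite -subr_eq0; apply/eqP; apply: bz.
  have gwz : dotv g (w - - dotv g w *: z) = 0.
    by rewrite dotvBr dotvZr gz; ring.
  case=> [i|[]]; rewrite ?inE /= ?dotvNl ?gwz ?oppr0 //.
  case: ifP => iT; last by rewrite !dotv0l.
  by move=> /eqP zi; rewrite dotvBr dotvZr zi mulr0 subr0 Tw.
have [->|y0] := eqVneq y 0; first by rewrite dotv0r.
have gy : dotv g y < 0.
  rewrite lt_neqAle; apply/andP; split; last first.
    by rewrite dotv_suml; apply: sumr_le0.
  by apply: contra y0 => /eqP /(gT _ Cy) ->.
have := slice ((- dotv g y)^-1 *: y); rewrite /= dotvZr pmulr_rge0; last first.
  by rewrite invr_gt0 oppr_gt0.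
have gy' : - dotv g y != 0 by rewrite gt_eqF // oppr_gt0.
apply; case=> [i|[]] /=; rewrite dotvZr ?dotvNl.
- case: ifP => iT; last by rewrite dotv0l mulr0.
  by rewrite pmulr_rle0 ?invr_gt0 ?oppr_gt0 // Cy.
- by rewrite -[X in _ * X]opprK mulrN mulVf.
- by rewrite mulVf.
Qed.

(** The edge consists of the points where the tight rows that vanish on the
    extreme direction are still tight. *)
Lemma extreme_direction_edge (R : realType) (I : finType) n
    (a : I -> 'cV[R]_n) (d : I -> R) v y :
  halfspaces a d v -> (forall i, i \in tight a d v -> dotv (a i) y <= 0) ->
  y != 0 ->
  (forall z, (forall i, i \in tight a d v -> dotv (a i) y = 0 ->
    dotv (a i) z = 0) -> exists t, z = t *: y) ->
  exists E, [/\ edge (halfspaces a d) E, E v &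
    exists2 e : R, 0 < e & E (v + e *: y)].
Proof.
move=> av ay y0 ext.
pose S := [set i in tight a d v | dotv (a i) y == 0].
have ST i : i \in S -> i \in tight a d v /\ dotv (a i) y = 0.
  by rewrite inE => /andP[-> /eqP].
have Ev : subface a d S v by split => // i /ST [/tightP].
have [e e0 ae] := small_step av ay.
have Ee : subface a d S (v + e *: y).
  split => // i /ST [/tightP iv yi].
  by rewrite dotvDr dotvZr yi mulr0 addr0.
exists (subface a d S); split => //; last by exists e.
split; first by apply: subface_face; exists v.
exists v, (e *: y); split => //.
- move=> j; suff -> : col j (e *: y) = e *: y by [].
  by apply/colP => l; rewrite !mxE (ord1 j).
- by rewrite -mxrank_tr rank_rV trmx_eq0 scaler_eq0 gt_eqF //= y0.
- move=> x [ax Sx]; have [i it yi|t xv] := ext (x - v).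
    by rewrite dotvBr (tightP it) Sx ?subrr // inE it yi eqxx.
  exists (t / e)%:M; rewrite mul_mx_scalar scalerA divfK ?gt_eqF // -xv.
  by rewrite addrC subrK.
Qed.

(** The normals of a facet are the left kernel of a matrix of corank one. *)
Lemma facet_normal_unique (R : realType) n e (F : set 'cV[R]_n)
    (p q : 'cV[R]_n) r s :
  e.+1 = n -> affine_dim F e -> p != 0 ->
  (forall x, F x -> dotv p x = r) -> (forall x, F x -> dotv q x = s) ->
  exists t, q = t *: p.
Proof.
move=> en [x0 [V [Fx0 FV rV _]]] p0 pF qF.
have ker w c : (forall x, F x -> dotv w x = c) -> (w^T <= kermx V)%MS.
  move=> wF; apply/sub_kermxP; apply/rowP => j; rewrite mxE.
  have : dotv w (x0 + col j V) = dotv w x0 by rewrite !wF.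
  rewrite dotvDr => /eqP; rewrite -subr_eq0 addrAC subrr add0r dotvE => /eqP h.
  by rewrite mxE -[RHS]h; apply: eq_bigr => k _; rewrite !mxE.
have pk := ker _ _ pF.
have rk : \rank p^T = \rank (kermx V).
  have n1 : (n - e = 1)%N by rewrite -en subSnn.
  by rewrite mxrank_ker rV n1 rank_rV trmx_eq0 p0.
have kp : (kermx V <= p^T)%MS.
  by have := mxrank_leqif_sup pk; rewrite /leqif rk eqxx => -[_ <-].
have /sub_rVP [t tE] := submx_trans (ker _ _ qF) kp.
by exists t; apply: trmx_inj; rewrite tE linearZ.
Qed.

Lemma Zbasis_dual n (e : 'I_n -> 'cV[int]_n) : Zbasis e ->
  exists f : 'I_n -> 'cV[int]_n,
    (forall i j, dotz (f i) (e j) = (i == j)%:R) /\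
    forall (R : realType) (x : 'cV[R]_n),
      x = \sum_i dotv (real_mx R (f i)) x *: real_mx R (e i).
Proof.
move=> eb; have /(_ _)/cid-/all_sig [c cE] : forall j : 'I_n,
    exists c : 'cV[int]_n, delta_mx j 0 = \sum_i c i 0 *: e i.
  by move=> j; have [c [cE _]] := eb (delta_mx j 0); exists c.
pose E := \matrix_(i, j) e j i 0; pose C := \matrix_(i, j) c j i 0.
have EC : E *m C = 1%:M.
  apply/matrixP => i j.
  have := congr1 (fun x : 'cV[int]_n => x i 0) (cE j).
  rewrite mxE eqxx andbT => h; rewrite mxE [RHS]mxE h summxE.
  by apply: eq_bigr => k _; rewrite !mxE mulrC.
have CE := mulmx1C EC.
exists (fun i => (row i C)^T); split => [i j|R x].
  rewrite -[RHS](_ : (1%:M : 'M[int]_n) i j = _); last by rewrite mxE.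
  rewrite -CE mxE dotzE; apply: eq_bigr => k _; by rewrite !mxE.
have : real_mx R E *m (real_mx R C *m x) = x.
  rewrite mulmxA /real_mx -map_mxM EC map_mx1 mul1mx //.
move=> {1}<-; apply/colP => k; rewrite mxE summxE; apply: eq_bigr => i _.
by rewrite real_mx_dot !mxE mulrC.
Qed.

Section SmoothVertex.
Variables (R : realType) (I : finType) (n : nat).
Variables (a : I -> 'cV[int]_n) (d : I -> int).
Let A := @real_rows R I n a.
Let D := @real_bounds R I d.
Let P := halfspaces A D.
Hypothesis smoothP : smooth_polytope P.
Hypothesis a_primitive : forall i, primitive (a i).
Hypothesis a_facet : forall i, facet P (P `&` [set x | dotv (A i) x = D i]).
Hypothesis a_inj : forall i j, a i = a j -> d i = d j -> i = j.

(** At a vertex of a smooth polytope the tangent cone is generated by the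
    primitive edge vectors, so that the coordinates in the edge basis are
    nonnegative on it. *)
Lemma edge_coordinates_ge0 v (e f : 'I_n -> 'cV[int]_n) : vertex P v ->
  primitive_edge_vectors P v = range e ->
  (forall i j, dotz (f i) (e j) = (i == j)%:R) ->
  forall i y, (forall k, k \in tight A D v -> dotv (A k) y <= 0) ->
    0 <= dotv (real_mx R (f i) : 'cV_n) y.
Proof.
move=> vv eE fe i; have [av bv] := vertex_basic_point vv.
apply: cone_extreme_ind => // y Cy y0 ext.
have [E [eE' Ev [r r0 Er]]] := extreme_direction_edge av Cy y0 ext.
case: smoothP => _ _ _ ratP _; have [z [z0 zE]] := ratP _ eE'.
have [s] := zE _ _ Ev Er; rewrite addrAC subrr add0r => rys.
have z0' : z != 0 by apply: contra z0 => /eqP ->; rewrite real_mx0.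
have [g g0 [w pw zw]] := primitive_multiple z0'.
have yw : y = (s * g%:R / r) *: real_mx R w.
  apply: (scalerI (lt0r_neq0 r0)).
  by rewrite rys zw real_mxZ !scalerA; congr (_ *: _); field; rewrite gt_eqF.
have [w' [pw' [t t0 yw']]] : exists w' : 'cV[int]_n, primitive w' /\
    exists2 t : R, 0 < t & y = t *: real_mx R w'.
  have [t0|t0|t0] := ltgtP 0 (s * g%:R / r).
  - by exists w; split => //; exists (s * g%:R / r).
  - exists (- w); split; last first.
      exists (- (s * g%:R / r)); first by rewrite oppr_gt0.
      by rewrite real_mxN scaleNr scalerN opprK.
    by rewrite /primitive -[RHS]pw; apply: eq_bigr => k _; rewrite mxE abszN.
  - by move: y0; rewrite yw -t0 scale0r eqxx.
have : primitive_edge_vectors P v w'.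
  split => //; exists E; split => //; exists (r * t); first by rewrite mulr_gt0.
  by rewrite -scalerA -yw'.
rewrite eE => -[j _ ew]; rewrite yw' -ew dotvZr dotv_real fe.
apply: mulr_ge0; first exact: ltW.
by rewrite ler0z ler0n.
Qed.

(** On the facet of a tight row, all the terms of the expansion of the row in
    the dual basis vanish; since the facet has only one normal direction, one
    single term remains. *)
Lemma tight_row_dual v (e f : 'I_n -> 'cV[int]_n) k : vertex P v ->
  primitive_edge_vectors P v = range e ->
  (forall i j, dotz (f i) (e j) = (i == j)%:R) ->
  (forall x : 'cV[R]_n,
    x = \sum_i dotv (real_mx R (f i)) x *: real_mx R (e i)) ->
  k \in tight A D v -> exists i, a k = - f i.
Proof.
move=> vv eE fe ex kT; have [av bv] := vertex_basic_point vv.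
have ae i : dotz (a k) (e i) <= 0.
  have : primitive_edge_vectors P v (e i) by rewrite eE; exists i.
  move=> [_ [E [[[_ [c ->]] _] _ [t t0 [/(_ k)]]]]].
  rewrite dotvDr dotvZr (tightP kT) gerDl pmulr_rle0 // dotv_real.
  by rewrite -[0]/(0%:~R) ler_int.
have p0 : A k != 0 by exact: primitive_neq0.
have [i ai] : exists i, dotz (a k) (e i) != 0.
  apply: contrapT => /forallNP h; case/eqP: p0; apply: dotv_eq0.
  rewrite [X in dotv _ X]ex dotv_sumr big1 // => i _.
  rewrite dotvZr !dotv_real.
  by have /negP := h i; rewrite negbK => /eqP ->; rewrite mulr0.
exists i; have [_ [e' en dF]] := a_facet k.
have fF x : (P `&` [set x | dotv (A k) x = D k]) x ->
    dotv (real_mx R (f i)) x = dotv (real_mx R (f i)) v.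
  move=> [Px /= xk].
  have Cx j : j \in tight A D v -> dotv (A j) (x - v) <= 0.
    by move=> /tightP jv; rewrite dotvBr jv subr_le0; exact: Px.
  have fx j := edge_coordinates_ge0 vv eE fe j Cx.
  have : \sum_j - (dotv (real_mx R (f j)) (x - v) *
      dotv (A k) (real_mx R (e j))) == 0.
    rewrite sumrN oppr_eq0; apply/eqP; transitivity (dotv (A k) (x - v)).
      by rewrite {2}[x - v]ex dotv_sumr; apply: eq_bigr => j _; rewrite dotvZr.
    by rewrite dotvBr xk (tightP kT) subrr.
  rewrite psumr_eq0 => [/allP/(_ i (mem_index_enum i))|j _]; last first.
    by rewrite oppr_ge0 mulr_ge0_le0 // dotv_real -[0]/(0%:~R) ler_int.
  rewrite /= oppr_eq0 mulf_eq0 dotv_real intr_eq0 (negbTE ai) orbF dotvBr.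
  by rewrite subr_eq0 => /eqP.
have [t ft] := facet_normal_unique en dF p0 (fun x h => h.2) fF.
have ta : t * (dotz (a k) (e i))%:~R = 1.
  by rewrite -dotv_real -dotvZl -ft dotv_real fe eqxx.
have aE : a k = dotz (a k) (e i) *: f i.
  by apply: (@real_mx_inj R); rewrite real_mxZ ft scalerA mulrC ta scale1r.
have := a_primitive k; rewrite {1}aE => /primitive_scale.
move: aE (ae i); case: (dotz (a k) (e i)) => [[|[|l]]|[|l]] //= -> _ _.
by rewrite scaleN1r.
Qed.

(** Different tight rows are opposite to different vectors of the dual basis of
    the edge basis, since a repeated row would be redundant. *)
Lemma smooth_vertex_dual v : vertex P v ->
  exists u, dual_family a (tight A D v) u.
Proof.
move=> vv; case: smoothP => _ _ _ _ /(_ _ vv) [e eb eE].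
have [f [fe ex]] := Zbasis_dual eb.
have /(_ _)/cid-/all_sig [u uE] : forall k, exists w : 'cV[int]_n,
    k \in tight A D v -> exists2 i, a k = - f i & w = - e i.
  move=> k; have [kT|kT] := boolP (k \in tight A D v); last by exists 0.
  have [i aki] := tight_row_dual vv eE fe (ex R) kT.
  by exists (- e i) => _; exists i.
exists u => k j kT jT.
have [i ai ui] := uE _ kT; have [l al ul] := uE _ jT.
have -> : dotz (a k) (u j) = dotz (f i) (e l).
  by rewrite ai ul !dotzE; apply: eq_bigr => p _; rewrite !mxE mulrNN.
rewrite fe; have [il|il] := eqVneq i l; have [kj|kj] := eqVneq k j => //.
  case/eqP: kj; have akj : a k = a j by rewrite ai al il.
  apply: a_inj => //; apply: (@intr_inj R).
  have vk := tightP kT; rewrite /A /real_rows akj in vk.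
  exact: etrans (esym vk) (tightP jT).
case/eqP: il.
have : dotz (f i) (e i) = dotz (f l) (e i).
  by rewrite -[f i]opprK -ai kj al opprK.
by rewrite !fe eqxx; case: eqP => // ->.
Qed.

End SmoothVertex.

(** * Deforming a smooth polytope within its normal fan *)

Lemma convex_combination_tight (R : realType) (p q x y X Y : R) :
  0 < p -> 0 <= q -> y <= Y ->
  p * X + q * Y - (p * x + q * y) = 0 -> X <= x.
Proof.
move=> p0 q0 yY h; rewrite -(ler_pM2l p0) -subr_le0.
have : 0 <= q * (Y - y) by rewrite mulr_ge0 // subr_ge0.
lra.
Qed.

Section Deformation.
Variables (R : realType) (I : finType) (n : nat).
Variables (a : I -> 'cV[int]_n) (c : I -> int).
Let A := @real_rows R I n a.
Let D := @real_bounds R I c.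
Let P := halfspaces A D.
Hypothesis recP : trivial_recession A.
Hypothesis P_row : forall k, exists2 x, P x & dotv (A k) x = D k.
Hypothesis P_dual : forall v, vertex P v ->
  exists u, dual_family a (tight A D v) u.

(** Tightness of a row at a vertex is seen in the normal fan: the tight rows
    are exactly those that belong to the normal cone. *)
Lemma normal_fan_vertex (c' : I -> int) v :
  normally_isomorphic (halfspaces A (@real_bounds R I c')) P -> vertex P v ->
  exists2 w, halfspaces A (@real_bounds R I c') w &
    tight A (@real_bounds R I c') w = tight A D v.
Proof.
move=> iso vv; have [u du] := P_dual vv; have bv := vertex_basic_point vv.
set P' := halfspaces A _ in iso *; set D' := real_bounds R c' in P' iso *.
have : normal_fan P (normal_cone P [set v]) by exists [set v].
rewrite -iso => -[F [[w Fw] [f FE]] NE].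
have coneP k : normal_cone P' F (A k) <-> k \in tight A D v.
  rewrite NE; split => [kN|kT x y /= -> Py]; last first.
    by rewrite (tightP kT); exact: Py.
  have [x Px xk] := P_row k; rewrite inE eq_le; apply/andP; split.
    exact: bv.1.
  by rewrite -xk; apply: kN.
have P'w : P' w by move: Fw; rewrite FE => -[].
have wT k : k \in tight A D v -> forall y, P' y -> dotv (A k) y <= dotv (A k) w.
  by move=> /coneP kN y P'y; apply: kN.
have Fw1 x : F x -> x = w.
  move=> Fx; apply/eqP; rewrite -subr_eq0; apply/eqP; apply: bv.2 => k kT.
  have P'x : P' x by move: Fx; rewrite FE => -[].
  rewrite dotvBr; apply/eqP; rewrite subr_eq0 eq_le wT //=.
  by move/coneP : kT; apply.
exists w => //; apply/setP => k; apply/idP/idP => kT.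
  apply/coneP => x y /Fw1 -> P'y; rewrite (tightP kT); exact: P'y.
apply: contraT => nkT.
have sub j : j \in tight A D' w -> j \in tight A D v.
  move=> jT; apply/coneP => x y /Fw1 -> P'y; rewrite (tightP jT); exact: P'y.
have [j jT|e e0 P'e] := @small_step _ _ _ A D' w (real_mx R (u k)) P'w.
  rewrite (dual_family_real R du (sub j jT) kT).
  by case: eqP jT nkT => // -> ->.
have := wT k kT _ P'e; rewrite dotvDr dotvZr (dual_family_real R du) //.
by rewrite eqxx mulr1 gerDl leNgt e0.
Qed.

Variable b : I -> int.
Hypothesis P_plus : forall v, vertex P v ->
  exists2 w, halfspaces A (@real_bounds R I (fun k => c k + b k)) w &
    tight A (@real_bounds R I (fun k => c k + b k)) w = tight A D v.
Hypothesis P_minus : forall v, vertex P v ->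
  exists2 w, halfspaces A (@real_bounds R I (fun k => c k - b k)) w &
    tight A (@real_bounds R I (fun k => c k - b k)) w = tight A D v.

(** The vertices of the intermediate polytopes are the convex combinations of
    corresponding vertices of the two extreme ones. *)
Lemma deformation_tight t x : -1 <= t -> t <= 1 ->
  (forall k, dotv (A k) x <= D k + t * (b k)%:~R) ->
  exists2 v, vertex P v & forall k, dotv (A k) x = D k + t * (b k)%:~R ->
    k \in tight A D v.
Proof.
move=> t1 t2 xt; pose S := [set k | dotv (A k) x == D k + t * (b k)%:~R].
have [|v vv vmax] := @max_at_vertex _ _ _ A D (\sum_(k in S) A k) recP.
  have [v vv] : exists v, halfspaces A D v; last by exists v.
  case: (pickP (@predT I)) => [k _|I0].
    by have [y Py _] := P_row k; exists y.
  by exists 0 => k; have := I0 k.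
exists v => // k xk; have [u du] := P_dual vv; have bv := vertex_basic_point vv.
have [w aw wT] := P_plus vv; have [w' aw' w'T] := P_minus vv.
(* y corresponds to v in the intermediate polytope; v is maximal for the sum of
   the rows in S, and so is y, which makes these rows tight at y *)
pose y := ((1 + t) / 2) *: w + ((1 - t) / 2) *: w'.
have yE j : dotv (A j) y =
    (1 + t) / 2 * dotv (A j) w + (1 - t) / 2 * dotv (A j) w'.
  by rewrite dotvDr !dotvZr.
have cE j : D j + t * (b j)%:~R = (1 + t) / 2 * (c j + b j)%:~R +
    (1 - t) / 2 * (c j - b j)%:~R.
  by rewrite /D /real_bounds intrD intrB; field.
have s1 : 0 <= (1 + t) / 2 by lra.
have s2 : 0 <= (1 - t) / 2 by lra.
have yle j : dotv (A j) y <= D j + t * (b j)%:~R.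
  by rewrite yE cE lerD // ler_wpM2l.
have yeq j : j \in tight A D v -> dotv (A j) y = D j + t * (b j)%:~R.
  move=> jT; rewrite yE cE.
  have jw := jT; rewrite -wT in jw; have jw' := jT; rewrite -w'T in jw'.
  by rewrite (tightP jw) (tightP jw').
have uy : dotv (\sum_(k in S) A k) x <= dotv (\sum_(k in S) A k) y.
  rewrite -subr_ge0 -dotvBr [y - x](dual_expansion bv du) dotv_sumr.
  apply: sumr_ge0 => j jT; rewrite dotvZr mulr_ge0 //.
    by rewrite dotvBr yeq // subr_ge0.
  have [e e0 /vmax] := vertex_edge_step bv du jT.
  by rewrite dotvDr dotvZr dotvNr gerDl mulrN oppr_le0 pmulr_rge0.
have kS : k \in S by rewrite inE; apply/eqP.
have : \sum_(j in S) (D j + t * (b j)%:~R - dotv (A j) y) == 0.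
  rewrite eq_le; apply/andP; split; last first.
    by apply: sumr_ge0 => j _; rewrite subr_ge0.
  rewrite sumrB subr_le0 -dotv_suml; apply: le_trans uy.
  rewrite dotv_suml; apply: ler_sum => j.
  by rewrite inE => /eqP ->.
rewrite psumr_eq0 => [/allP/(_ k (mem_index_enum k))|j _]; last first.
  by rewrite subr_ge0.
rewrite kS /= yE cE => /eqP kE.
have h1 : dotv (A k) w <= (c k + b k)%:~R := aw k.
have h2 : dotv (A k) w' <= (c k - b k)%:~R := aw' k.
have [t0|t0] := ltP (-1) t.
  have p0 : 0 < (1 + t) / 2 by lra.
  have h := convex_combination_tight p0 s2 h2 kE.
  by rewrite -wT inE; apply/eqP/le_anti/andP; split.
have p0 : 0 < (1 - t) / 2 by lra.
rewrite [X in X - _]addrC [X in _ - X]addrC in kE.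
have h := convex_combination_tight p0 s1 h1 kE.
by rewrite -w'T inE; apply/eqP/le_anti/andP; split.
Qed.

(** * The prism over the deformation *)

Definition prism_row (i : I + bool) : 'cV[int]_(n + 1) :=
  match i with
  | inl k => col_mx (a k) (- b k)%:M
  | inr s => col_mx 0 ((-1) ^+ s)%:M
  end.

Definition prism_bound (i : I + bool) : int :=
  match i with inl k => c k | inr _ => 1 end.

Let B := @real_rows R _ _ prism_row.
Let E := @real_bounds R _ prism_bound.

Lemma prism_dot u s (y : 'cV[R]_(n + 1)) :
  dotv (real_mx R (col_mx u s%:M)) y =
  dotv (real_mx R u) (usubmx y) + s%:~R * dsubmx y 0 0.
Proof.
rewrite -{1}[y]vsubmxK /real_mx map_col_mx dotv_col_mx; congr (_ + _).
by rewrite dotvE big_ord1 !mxE eqxx mulr1n.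
Qed.

Lemma prismP (y : 'cV[R]_(n + 1)) : halfspaces B E y <->
  [/\ -1 <= dsubmx y 0 0, dsubmx y 0 0 <= 1 &
    forall k, dotv (A k) (usubmx y) <= D k + dsubmx y 0 0 * (b k)%:~R].
Proof.
have r1 k : dotv (B (inl k)) y =
    dotv (A k) (usubmx y) - dsubmx y 0 0 * (b k)%:~R.
  by rewrite /B /real_rows prism_dot rmorphN mulNr mulrC.
have r2 s : dotv (B (inr s)) y = (-1) ^+ s * dsubmx y 0 0.
  rewrite /B /real_rows prism_dot real_mx0 dotv0l add0r.
  by rewrite rmorphXn rmorphN rmorph1.
split => [By|[h1 h2 h3] [k|s]].
- split; last by move=> k; have := By (inl k); rewrite r1 lerBlDr.
    by have := By (inr true); rewrite r2 expr1 mulN1r lerNl.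
  by have := By (inr false); rewrite r2 expr0 mul1r.
- by rewrite r1 lerBlDr; exact: h3.
- by rewrite r2; case: s; rewrite ?expr1 ?expr0 /E /real_bounds /=; lra.
Qed.

Lemma prism_trivial_recession : trivial_recession B.
Proof.
move=> z Bz; have t0 : dsubmx z 0 0 = 0.
  apply/eqP; rewrite eq_le; have := Bz (inr false); have := Bz (inr true).
  rewrite /B /real_rows !prism_dot real_mx0 !dotv0l !add0r /=.
  by rewrite !intr_sign !mulN1r !mul1r oppr_le0 => -> ->.
rewrite -[z]vsubmxK; suff -> : usubmx z = 0.
  rewrite (_ : dsubmx z = 0) ?col_mx0 //.
  by apply/colP => i; rewrite (ord1 i) t0 mxE.
apply: recP => k; have := Bz (inl k).
by rewrite /B /real_rows prism_dot t0 mulr0 addr0.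
Qed.

(** Over the tight rows of a vertex of P the two extreme facets of the prism
    have the common dual vector (z, 1), up to sign, where z solves the tight
    equations with right-hand side b. *)
Lemma prism_dual y : halfspaces B E y ->
  exists2 u, dual_family prism_row (tight B E y) u &
    exists2 z, dotz (prism_row (inr false)) z = 1 &
      forall k, inl k \in tight B E y -> dotz (prism_row (inl k)) z = 0.
Proof.
move=> By; have [t1 t2 ty] := (prismP y).1 By.
have [v vv vT] := deformation_tight t1 t2 ty.
have [u du] := P_dual vv; set T := tight A D v in vT du.
have kT k : inl k \in tight B E y -> k \in T.
  move=> /tightP; rewrite /B /real_rows prism_dot intrN mulNr => h; apply: vT.
  have -> : D k = dotv (A k) (usubmx y) - (b k)%:~R * dsubmx y 0 0.
    exact: esym.
  by ring.
pose z : 'cV[int]_(n + 1) := col_mx (\sum_(j in T) b j *: u j) 1%:M.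
have dot1 (s : int) (x : int) : dotz (s%:M : 'cV_1) x%:M = s * x.
  by rewrite dotzE big_ord1 !mxE eqxx !mulr1n.
have zk k : inl k \in tight B E y -> dotz (prism_row (inl k)) z = 0.
  move=> /kT kv; rewrite dotz_col_mx dot1 mulr1.
  have -> : dotz (a k) (\sum_(j in T) b j *: u j) = b k.
    rewrite dotz_sumr (bigD1 k) //= dotzZr du // eqxx mulr1 big1 ?addr0 // => j.
    by move=> /andP[jT /negbTE jk]; rewrite dotzZr du // eq_sym jk mulr0.
  by rewrite subrr.
have zs s : dotz (prism_row (inr s)) z = (-1) ^+ s.
  by rewrite dotz_col_mx dotz0l add0r dot1 mulr1.
pose w (i : I + bool) : 'cV[int]_(n + 1) := match i with
  | inl k => col_mx (u k) 0
  | inr s => (-1) ^+ s *: z end.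
exists w; last by exists z => //; rewrite zs.
case=> [k|s] [j|s'] iT jT; rewrite /w.
- by rewrite dotz_col_mx dotz0r addr0 du ?kT.
- by rewrite dotzZr zk // mulr0.
- by rewrite dotz_col_mx dotz0l dotz0r addr0.
rewrite dotzZr zs; case: (eqVneq s s') => [->|ss'].
  by rewrite eqxx -expr2 sqrr_sign.
have h (r : bool) : inr r \in tight B E y -> (-1) ^+ r * dsubmx y 0 0 = 1.
  move=> /tightP; rewrite /B /real_rows prism_dot real_mx0 dotv0l add0r.
  by rewrite intr_sign.
exfalso; have := h _ iT; have := h _ jT.
by case: s s' ss' {iT jT} => [] [] //= _; rewrite expr1 expr0; lra.
Qed.

Lemma prism_unimodular : unimodular_presentation R prism_row prism_bound.
Proof.
split; first exact: prism_trivial_recession.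
by move=> y /prism_dual [u du _]; exists u.
Qed.

End Deformation.

(** * From a polytope through the origin to one around it *)

Section OriginInFace.
Variables (R : realType) (I : finType) (n : nat).
Variables (a : I -> 'cV[int]_n) (d : I -> int).
Let A := @real_rows R I n a.
Let D := @real_bounds R I d.
Let Q := halfspaces A D.
Hypothesis uni : unimodular_presentation R a d.
Variable T : {set I}.
Hypothesis T_tight : T = tight A D 0.
Variable u : I -> 'cV[int]_n.
Hypothesis du : dual_family a T u.
Hypothesis d_ge0 : forall i, 0 <= d i.

Let U i := real_mx R (u i).

(** The projection onto the linear span of the smallest face through the
    origin, along the dual vectors of the rows that define this face. *)
Definition face_proj (x : 'cV[int]_n) := x - \sum_(i in T) dotz (a i) x *: u i.
Definition real_face_proj (x : 'cV[R]_n) :=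
  x - \sum_(i in T) dotv (A i) x *: U i.

(** The adjoint of the projection. *)
Definition face_restr (w : 'cV[int]_n) := w - \sum_(i in T) dotz w (u i) *: a i.

Lemma real_face_projE x :
  real_mx R (face_proj x) = real_face_proj (real_mx R x).
Proof.
rewrite /face_proj real_mxD real_mxN real_mx_sum; congr (_ - _).
by apply: eq_bigr => i _; rewrite real_mxZ -dotv_real.
Qed.

Lemma face_restrE w x : dotz (face_restr w) x = dotz w (face_proj x).
Proof.
rewrite dotzC !dotzDr !dotzNr !dotz_sumr dotzC; congr (_ - _).
by apply: eq_bigr => i _; rewrite !dotzZr mulrC (dotzC x).
Qed.

Lemma real_face_restrE w x :
  dotv (real_mx R (face_restr w)) x = dotv (real_mx R w) (real_face_proj x).
Proof.
rewrite /face_restr real_mxD real_mxN real_mx_sum dotvDl dotvNl dotvBr.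
rewrite dotv_suml dotv_sumr; congr (_ - _); apply: eq_bigr => i _.
by rewrite real_mxZ dotvZl dotvZr dotv_real mulrC.
Qed.

Lemma face_proj_dual j : j \in T -> face_proj (u j) = 0.
Proof.
move=> jT; rewrite /face_proj (bigD1 j) //= du // eqxx scale1r big1 ?addr0.
  by rewrite subrr.
by move=> i /andP[iT /negbTE ij]; rewrite du // ij scale0r.
Qed.

Lemma face_proj_id x :
  (forall i, i \in T -> dotz (a i) x = 0) -> face_proj x = x.
Proof.
move=> ax; rewrite /face_proj big1 ?subr0 // => i /ax ->.
by rewrite scale0r.
Qed.

Lemma real_face_proj_id x :
  (forall i, i \in T -> dotv (A i) x = 0) -> real_face_proj x = x.
Proof.
move=> ax; rewrite /real_face_proj big1 ?subr0 // => i /ax ->.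
by rewrite scale0r.
Qed.

Lemma row_face_proj i x : i \in T -> dotv (A i) (real_face_proj x) = 0.
Proof.
move=> iT; rewrite dotvBr dotv_sumr (bigD1 i) //= dotvZr.
rewrite (dual_family_real R du) // eqxx mulr1 big1 ?addr0 ?subrr // => j.
move=> /andP[jT /negbTE ji].
by rewrite dotvZr (dual_family_real R du) // eq_sym ji mulr0.
Qed.

Lemma in_T i : (i \in T) = (d i == 0).
Proof. by rewrite T_tight inE dotv0r eq_sym /D /real_bounds intr_eq0. Qed.

(** The product of the smallest face through the origin with a cube: the rows
    outside of T are pulled back along the projection, and the coordinates
    given by the rows in T range over [-1, 1]. Choosing a lattice basis of the
    span of the face is thereby avoided. The zero rows, with bound 1, only make
    the index set uniform. *)
Definition padded_row (p : I * bool) : 'cV[int]_n :=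
  if p.1 \in T then (-1) ^+ p.2 *: a p.1 else
  if p.2 then 0 else face_restr (a p.1).

Definition padded_bound (p : I * bool) : int :=
  if p.1 \in T then 1 else if p.2 then 1 else d p.1.

Let B := @real_rows R _ _ padded_row.
Let E := @real_bounds R _ padded_bound.

Lemma padded_bound_gt0 p : 0 < padded_bound p.
Proof.
rewrite /padded_bound; case: ifP => // /negbT pT; case: p.2 => //.
by rewrite lt_neqAle d_ge0 eq_sym -in_T pT.
Qed.

Lemma padded_row_in i s x : i \in T ->
  dotv (B (i, s)) x = (-1) ^+ s * dotv (A i) x.
Proof.
by move=> iT; rewrite /B /real_rows /padded_row /= iT real_mxZ dotvZl intr_sign.
Qed.

Lemma padded_row_out i x : i \notin T ->
  dotv (B (i, false)) x = dotv (A i) (real_face_proj x).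
Proof.
by move=> /negbTE iT; rewrite /B /real_rows /padded_row /= iT real_face_restrE.
Qed.

Lemma padded_proj x : halfspaces B E x -> Q (real_face_proj x).
Proof.
move=> Bx i; have [iT|iT] := boolP (i \in T).
  by rewrite row_face_proj // ler0z.
have := Bx (i, false); rewrite padded_row_out //.
by rewrite /E /real_bounds /padded_bound /= (negbTE iT).
Qed.

Lemma padded_unimodular : unimodular_presentation R padded_row padded_bound.
Proof.
split => [z Bz|x Bx].
  have zT i : i \in T -> dotv (A i) z = 0.
    move=> iT; have := Bz (i, true); have := Bz (i, false).
    rewrite !padded_row_in // mul1r mulN1r oppr_le0 => h1 h2.
    by apply/eqP; rewrite eq_le h1 h2.
  apply: uni.1 => i; have [/zT -> //|iT] := boolP (i \in T).
  by have := Bz (i, false); rewrite padded_row_out // real_face_proj_id.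
have [w dw] := uni.2 _ (padded_proj Bx).
set T1 := tight _ _ (real_face_proj x) in dw.
have TT1 i : i \in T -> i \in T1.
  move=> iT; rewrite inE row_face_proj //; move: iT; rewrite in_T => /eqP.
  by rewrite /real_bounds => ->.
have outT i s : (i, s) \in tight B E x -> i \notin T -> s = false /\ i \in T1.
  move=> /tightP + iT; case: s.
    rewrite /B /real_rows /padded_row /E /real_bounds /padded_bound /=.
    rewrite (negbTE iT) real_mx0 dotv0l => /eqP.
    by rewrite eq_sym intr_eq0.
  rewrite padded_row_out // /E /real_bounds /padded_bound /= (negbTE iT) => h.
  by split => //; rewrite inE; apply/eqP.
exists (fun p : I * bool => if p.1 \in T then (-1) ^+ p.2 *: u p.1 else w p.1).
move=> [i s] [j s'] iE jE; rewrite /padded_row /=.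
have [iT|iT] := boolP (i \in T); have [jT|jT] := boolP (j \in T).
- rewrite dotzZr dotzC dotzZr dotzC du // xpair_eqE.
  have [ij|] := eqVneq i j; last by rewrite !mulr0.
  have [->|ss'] := eqVneq s s'; first by rewrite mulr1 -expr2 sqrr_sign.
  exfalso; move: (tightP iE) (tightP jE); rewrite -ij !padded_row_in //.
  rewrite /E /real_bounds /padded_bound /= iT.
  by case: s s' ss' {iE jE} => [] [] //= _; rewrite ?expr0 ?expr1; lra.
- have [_ jT1] := outT _ _ jE jT; rewrite dotzC dotzZr dotzC dw ?(TT1 i) //.
  rewrite xpair_eqE; case: eqP iT jT => [-> -> //|_ _ _]; exact: mulr0.
- have [-> _] := outT _ _ iE iT; rewrite dotzZr face_restrE face_proj_dual //.
  rewrite dotz0r mulr0 xpair_eqE; case: eqP iT jT => [-> /negbTE -> //|_ _ _].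
  by [].
- have [-> iT1] := outT _ _ iE iT; have [-> jT1] := outT _ _ jE jT.
  rewrite face_restrE face_proj_id => [|k kT].
    by rewrite dw // xpair_eqE andbT.
  rewrite dw ?(TT1 k) //; case: eqP kT jT => [-> -> //|_ _ _].
  by [].
Qed.

(** A basis of the lattice does not lie in the kernel of a nonzero functional;
    projecting its vectors to the face gives a lattice point of height 1. *)
Lemma ewald_point_at_height (h z : 'cV[int]_n) :
  has_unimodular_basis (ewald_set (halfspaces B E)) ->
  (forall y, Q y -> `|dotv (real_mx R h) y| <= 1) ->
  (forall i, i \in T -> dotz (a i) z = 0) -> dotz h z = 1 ->
  exists x, [/\ dotz h x = 1, Q (real_mx R x) & Q (- real_mx R x)].
Proof.
move=> [e eb eE] hQ az hz.
have [c [zE _]] := eb z.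
have [k hk] : exists k, dotz h (face_proj (e k)) != 0.
  apply: contrapT => /forallNP hk; move: hz.
  rewrite -[z]face_proj_id // -face_restrE zE dotz_sumr big1 // => k _.
  rewrite dotzZr face_restrE; have /negP := hk k.
  by rewrite negbK => /eqP ->; rewrite mulr0.
have [[_ Be] [y By ye]] := eE k.
set x := face_proj (e k) in hk.
have Qx : Q (real_mx R x) by rewrite real_face_projE; exact: padded_proj.
have Qy : Q (- real_mx R x).
  rewrite (_ : - _ = real_face_proj y); first exact: padded_proj.
  rewrite real_face_projE -ye /real_face_proj opprD opprK opprK -sumrN.
  by congr (_ + _); apply: eq_bigr => i _; rewrite dotvNr scaleNr.
have := hQ _ Qx; rewrite dotv_real -intr_norm -[1]/(1%:~R) ler_int => hx.
have [h1|h1] : dotz h x = 1 \/ dotz h (- x) = 1.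
- move: hk hx; rewrite dotzNr.
  by case: (dotz h x) => [[|[|q]]|[|q]] //=; by [left|right].
- by exists x.
by exists (- x); rewrite real_mxN opprK.
Qed.

End OriginInFace.

(** * Neatness *)

Definition matrix_rows m n (A : 'M[int]_(m, n)) (k : 'I_m) : 'cV[int]_n :=
  (row k A)^T.

Lemma polyhedronE (R : realType) m n (A : 'M[int]_(m, n)) (c : 'cV[int]_m) :
  polyhedron A c = halfspaces (@real_rows R _ _ (matrix_rows A))
                              (@real_bounds R _ (fun k => c k 0)).
Proof.
by apply/seteqP; split => x Ax k; have := Ax k; rewrite real_mx_dot.
Qed.

(** The row and the primitive normal of a facet are proportional, with the
    bounds c k 0 and 1; hence c k 0 divides the row, which is primitive. *)
Lemma reflexive_bounds (R : realType) m n (A : 'M[int]_(m, n))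
    (c : 'cV[int]_m) (P : set 'cV[R]_n) :
  facet_description A c P -> reflexive_polytope P -> forall k, c k 0 = 1.
Proof.
move=> [PE prim fac _] [_ /nbhs_singleton P0 refl] k.
have ck0 : 0 <= c k 0.
  by move: P0; rewrite PE => /(_ k); rewrite mulmx0 mxE ler0z.
have [u _ [_ uF]] := refl _ (fac k).
have [[[x Fx] _] [e en dF]] := fac k.
have p0 : real_mx R (row k A)^T != 0 by exact: primitive_neq0.
have pF y : (P `&` [set x | (real_mx R A *m x) k 0 = (c k 0)%:~R]) y ->
    dotv (real_mx R (row k A)^T) y = (c k 0)%:~R.
  by move=> [_ /= <-]; rewrite real_mx_dot.
have qF y : (P `&` [set x | (real_mx R A *m x) k 0 = (c k 0)%:~R]) y ->
    dotv (real_mx R u) y = 1.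
  by rewrite uF => -[].
have [t tE] := facet_normal_unique en dF p0 pF qF.
have tc : t * (c k 0)%:~R = 1 by rewrite -(pF _ Fx) -dotvZl -tE qF.
have kE : (row k A)^T = c k 0 *: u.
  by apply: (@real_mx_inj R); rewrite real_mxZ tE scalerA mulrC tc scale1r.
have := prim k; rewrite kE => /primitive_scale ck1.
by rewrite -[LHS](gez0_abs ck0) ck1.
Qed.

(** Unimodular presentations are what remains of the two conjectures: a lattice
    basis in the symmetric part of the padded prism yields a lattice point of
    the prism at height 1 whose opposite is in the prism as well. *)
Lemma neat_of_unimodular_bases (R : realType) n (P : set 'cV[R]_n) :
  smooth_polytope P -> P 0 ->
  (forall (N : nat) (I : finType) (a : I -> 'cV[int]_N) (d : I -> int),
    unimodular_presentation R a d -> (forall i, 0 < d i) ->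
    (reflexive_polytope P -> forall i, d i = 1) ->
    has_unimodular_basis
      (ewald_set (halfspaces (@real_rows R _ _ a) (@real_bounds R _ d)))) ->
  neat P.
Proof.
move=> smoothP P0 ewald m A c facP b iso1 iso2.
have cE := reflexive_bounds facP; case: facP => PE prim fac irr.
pose a := matrix_rows A; pose c' k := c k 0; pose b' k := b k 0.
have {}PE : P = halfspaces (@real_rows R _ _ a) (@real_bounds R _ c').
  by rewrite PE polyhedronE.
have plusE : polyhedron A (c + b) = halfspaces (@real_rows R _ _ a)
    (@real_bounds R _ (fun k => c' k + b' k)).
  rewrite polyhedronE; congr halfspaces; apply/funext => k.
  by rewrite /real_bounds mxE.
have minusE : polyhedron A (c - b) = halfspaces (@real_rows R _ _ a)
    (@real_bounds R _ (fun k => c' k - b' k)).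
  rewrite polyhedronE; congr halfspaces; apply/funext => k.
  by rewrite /real_bounds !mxE.
rewrite plusE in iso1 *; rewrite minusE in iso2 *.
have facE k : P `&` [set x | (real_mx R A *m x) k 0 = (c k 0)%:~R] =
    P `&` [set x | dotv (@real_rows R _ _ a k) x = @real_bounds R _ c' k].
  by congr (_ `&` _); apply/seteqP; split => x /=; rewrite real_mx_dot.
have facP k : facet P (P `&` [set x | dotv (@real_rows R _ _ a k) x =
    @real_bounds R _ c' k]) by rewrite -facE.
have P_row k : exists2 x, P x &
    dotv (@real_rows R _ _ a k) x = @real_bounds R _ c' k.
  by have [[[x [Px xk]] _] _] := facP k; exists x.
have a_inj i j : a i = a j -> c' i = c' j -> i = j.
  move=> aij cij; apply/eqP/contraT => nij; case: (irr i).
  rewrite PE; apply/seteqP; split => x ax k.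
    by move=> _; rewrite real_mx_dot; exact: ax.
  have [->|ki] := eqVneq k i; last first.
    by rewrite /real_rows /a -real_mx_dot; exact: ax.
  rewrite /real_rows /real_bounds aij cij -real_mx_dot.
  by apply: ax; rewrite eq_sym.
rewrite PE in smoothP P0 facP P_row iso1 iso2.
have recP : trivial_recession (@real_rows R _ _ a).
  apply: polytope_trivial_recession; first by exists 0; exact: P0.
  by case: smoothP.
have P_dual := smooth_vertex_dual smoothP prim facP a_inj.
have P_plus v := normal_fan_vertex P_row P_dual iso1 (v := v).
have P_minus v := normal_fan_vertex P_row P_dual iso2 (v := v).
have uni := prism_unimodular recP P_row P_dual P_plus P_minus.
have d_ge0 i : 0 <= prism_bound c' i.
  by case: i => // k; have := P0 k; rewrite dotv0r ler0z.

have Q0 : halfspaces (@real_rows R _ _ (prism_row a b'))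
    (@real_bounds R _ (prism_bound c')) 0.
  by move=> i; rewrite dotv0r ler0z.
have [u du [z hz zk]] := prism_dual recP P_row P_dual P_plus P_minus Q0.
have [||||x [hx /prismP [_ _ Qx] /prismP [_ _ Qy]]] :=
    ewald_point_at_height du d_ge0 (R := R) (h := prism_row a b' (inr false))
      (z := z).
- apply: ewald.
  + exact: padded_unimodular.
  + exact: (@padded_bound_gt0 R _ _ (prism_row a b')).
  + move=> /cE c1 [[k|s] s']; rewrite /padded_bound /=; case: ifP => //.
    by rewrite /c' c1; case: s'.
    by case: s'.
- move=> y Qy; have := Qy (inr false); have := Qy (inr true).
  rewrite /real_rows !prism_dot real_mx0 !dotv0l !add0r !intr_sign.
  rewrite expr0 expr1 /real_bounds /= !mul1r mulN1r lerNl ler_norml => -> ->.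
  by [].
- case=> [k|s]; first exact: zk.
  by rewrite inE dotv0r /real_bounds /= eq_sym intr_eq0.
- by [].
have x1 : dsubmx (real_mx R x) 0 0 = 1.
  have := congr1 (fun t : int => t%:~R : R) hx; rewrite -dotv_real prism_dot.
  by rewrite real_mx0 dotv0l add0r expr0 mul1r.
exists (usubmx (real_mx R x)); split; [split|] => /=.
- move=> k; apply: le_trans (Qx k) _.
  by rewrite x1 mul1r /real_bounds intrD.
- exists (- usubmx (real_mx R x)); last by rewrite opprK.
  move=> k; have := Qy k; rewrite !linearN /= mxE x1 mulN1r.
  by rewrite /real_bounds intrB.
- by exists (usubmx x) => //; rewrite /real_mx map_usubmx.
Qed.

Theorem corollary2p4 (R : realType) :
  (ewald_conjecture R ->
     forall (n : nat) (P : set 'cV[R]_n), monotone_polytope P -> neat P) /\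
  (general_ewald_conjecture R ->
     forall (n : nat) (P : set 'cV[R]_n),
       smooth_polytope P -> lattice_polytope P -> P 0 -> neat P).
Proof.
split=> ewald n P.
  move=> [smoothP reflP]; have [_ /nbhs_singleton P0 _] := reflP.
  apply: neat_of_unimodular_bases => // N I a d uni d0 /(_ reflP) d1.
  apply: ewald; split; first exact: unimodular_smooth.
  exact: unimodular_reflexive.
move=> smoothP _ P0; apply: neat_of_unimodular_bases => // N I a d uni d0 _.
apply: ewald; first exact: unimodular_smooth.
  exact: unimodular_lattice.
by apply: halfspaces_interior => i; rewrite ltr0z.
Qed.
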